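(* Let $h: R \to S$ be a ring homomorphism. If $h$ has the stable prime extension property, then all fibers $\kappa_P \otimes_R S$ ($P$ prime in $R$) are geometrically reduced and irreducible $\kappa_P$-algebras. Moreover, under the hypothesis that all fibers of $h$ are geometrically reduced and irreducible, the following are equivalent: (i) $R \to S$ has the stable prime extension property; (ii) $R/\mathfrak{N}_R \to S/\mathfrak{N}_R S$ has the stable prime extension property, where $\mathfrak{N}_R$ is the nilradical of $R$; (iii) for every minimal prime $P$ of $R$, $R/P \to S/PS$ is flat; (iv) for every ideal $J$ of $R$ that is a finite intersection of prime ideals, $R/J \to S/JS$ is flat.
   Context: All rings are commutative with identity. A ring homomorphism $R \to S$ has the prime extension property if for every prime ideal $P$ of $R$, $PS$ is prime in $S$ or $PS = S$; it has the stable prime extension property if for every $n \ge 0$, $R[X_1,\dots,X_n] \to S[X_1,\dots,X_n]$ has the prime extension property. For a prime $P$ of $R$, $\kappa_P = R_P/PR_P$, and the fiber over $P$ is $\kappa_P \otimes_R S$. An algebra $T$ over a field $K$ is geometrically reduced and irreducible if $L \otimes_K T$ is a domain for every field extension $K \subseteq L$.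
   Formalization: ''All fibers are geometrically reduced and irreducible'' is read as ''all nonzero fibers are'', both as conclusion and as hypothesis; literally the first claim fails, e.g. Z → Q has the stable prime extension property but its fiber over (p) is the zero ring, which is not a domain. *)

(* Defs.v *)
(* All rings are commutative with identity; the zero ring is
   allowed (comPzRingType).  Constructions that mathcomp does not provide
   (quotient rings, polynomial rings in n variables, localization / residue
   fields, tensor products of algebras and of modules) are introduced by their
   defining universal properties, and statements quantify over all objects
   satisfying them (these exist and are unique up to unique isomorphism). *)
From Stdlib Require List.
From HB Require Import structures.
From mathcomp Require Import all_boot all_algebra.
Set Implicit Arguments.
Unset Strict Implicit.
Unset Printing Implicit Defensive.
Import GRing.Theory.
Local Open Scope ring_scope.

Definition ring_hom (A B : comPzRingType) (f : A -> B) : Prop :=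
  [/\ f 1 = 1, {morph f : x y / x + y} & {morph f : x y / x * y}].

Definition unitP (A : comPzRingType) (x : A) : Prop := exists y, x * y = 1.

Definition is_ideal (A : comPzRingType) (I : A -> Prop) : Prop :=
  [/\ I 0, (forall x y, I x -> I y -> I (x + y)) & (forall r x, I x -> I (r * x))].

Definition prime_ideal (A : comPzRingType) (P : A -> Prop) : Prop :=
  [/\ is_ideal P, ~ P 1 & (forall a b, P (a * b) -> P a \/ P b)].

Definition ext_ideal (A B : comPzRingType) (f : A -> B) (I : A -> Prop) : B -> Prop :=
  fun y => exists l : seq (B * A),
    (forall z, List.In z l -> I z.2) /\ y = \sum_(z <- l) z.1 * f z.2.

Definition minimal_prime (A : comPzRingType) (P : A -> Prop) : Prop :=
  prime_ideal P /\
  forall Q : A -> Prop, prime_ideal Q -> (forall x, Q x -> P x) -> forall x, P x -> Q x.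

Definition nilradical (A : comPzRingType) : A -> Prop :=
  fun x => exists n : nat, x ^+ n = 0.

Definition finite_int_primes (A : comPzRingType) (J : A -> Prop) : Prop :=
  exists Ps : seq (A -> Prop), Ps <> [::] /\
    (forall P, List.In P Ps -> prime_ideal P) /\
    (forall x, J x <-> (forall P, List.In P Ps -> P x)).

Definition is_quotient (A : comPzRingType) (I : A -> Prop)
    (Q : comPzRingType) (q : A -> Q) : Prop :=
  [/\ ring_hom q, (forall z : Q, exists x, q x = z) & (forall x, q x = 0 <-> I x)].

Definition is_polyring (n : nat) (A P : comPzRingType) (c : A -> P) (X : 'I_n -> P) : Prop :=
  ring_hom c /\
  forall (D : comPzRingType) (u : A -> D) (y : 'I_n -> D), ring_hom u ->
    exists! w : P -> D, [/\ ring_hom w, (forall a, w (c a) = u a) & (forall i, w (X i) = y i)].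

Definition PEP (A B : comPzRingType) (f : A -> B) : Prop :=
  forall P : A -> Prop, prime_ideal P ->
    prime_ideal (ext_ideal f P) \/ ext_ideal f P 1.

Definition stable_PEP (A B : comPzRingType) (f : A -> B) : Prop :=
  forall (n : nat) (PA : comPzRingType) (cA : A -> PA) (XA : 'I_n -> PA)
         (PB : comPzRingType) (cB : B -> PB) (XB : 'I_n -> PB) (F : PA -> PB),
    is_polyring cA XA -> is_polyring cB XB ->
    ring_hom F -> (forall a, F (cA a) = cB (f a)) -> (forall i, F (XA i) = XB i) ->
    PEP F.

Definition is_tensor_alg (A B C T : comPzRingType) (f : A -> B) (g : A -> C)
    (i : B -> T) (j : C -> T) : Prop :=
  [/\ ring_hom i, ring_hom j, (forall a, i (f a) = j (g a)) &
    forall (D : comPzRingType) (u : B -> D) (v : C -> D),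
      ring_hom u -> ring_hom v -> (forall a, u (f a) = v (g a)) ->
      exists! w : T -> D, [/\ ring_hom w, (forall b, w (i b) = u b) & (forall c, w (j c) = v c)]].

(* ---------- residue field  kappa_P = A_P / P A_P  (universal property:
   ring maps out of A_P/PA_P = ring maps out of A killing P and inverting A\P) *)
Definition is_residue_field (A : comPzRingType) (P : A -> Prop)
    (K : comPzRingType) (k : A -> K) : Prop :=
  [/\ ring_hom k, (forall a, P a -> k a = 0), (forall a, ~ P a -> unitP (k a)) &
    forall (D : comPzRingType) (u : A -> D), ring_hom u ->
      (forall a, P a -> u a = 0) -> (forall a, ~ P a -> unitP (u a)) ->
      exists! w : K -> D, ring_hom w /\ forall a, w (k a) = u a].

Definition is_domain (T : comPzRingType) : Prop :=
  (1 : T) <> 0 /\ forall x y : T, x * y = 0 -> x = 0 \/ y = 0.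

Definition geom_red_irr (K T : comPzRingType) (e : K -> T) : Prop :=
  forall (L : fieldType) (l : K -> L), ring_hom l ->
    forall (U : comPzRingType) (i : L -> U) (j : T -> U),
      is_tensor_alg l e i j -> is_domain U.

Definition fibers_geom_red_irr (A B : comPzRingType) (f : A -> B) : Prop :=
  forall P : A -> Prop, prime_ideal P ->
  forall (K : comPzRingType) (k : A -> K), is_residue_field P k ->
  forall (F : comPzRingType) (iK : K -> F) (jB : B -> F),
    is_tensor_alg k f iK jB -> (1 : F) <> 0 -> geom_red_irr iK.

Definition balanced (A B : comPzRingType) (f : A -> B) (M : lmodType A)
    (N : zmodType) (t : M -> B -> N) : Prop :=
  [/\ (forall m m' y, t (m + m') y = t m y + t m' y),
      (forall m y y', t m (y + y') = t m y + t m y') &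
      (forall a m y, t (a *: m) y = t m (f a * y))].

Definition is_tensor_mod (A B : comPzRingType) (f : A -> B) (M : lmodType A)
    (T : zmodType) (t : M -> B -> T) : Prop :=
  balanced f t /\
  forall (N : zmodType) (g : M -> B -> N), balanced f g ->
    exists! u : T -> N, {morph u : x y / x + y} /\ forall m y, u (t m y) = g m y.

Definition flat (A B : comPzRingType) (f : A -> B) : Prop :=
  forall (M M' : lmodType A) (phi : M -> M'),
    (forall a (x y : M), phi (a *: x + y) = a *: phi x + phi y) -> injective phi ->
    forall (T : zmodType) (t : M -> B -> T) (T' : zmodType) (t' : M' -> B -> T')
           (psi : T -> T'),
      is_tensor_mod f t -> is_tensor_mod f t' ->
      {morph psi : x y / x + y} -> (forall m y, psi (t m y) = t' (phi m) y) ->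
      injective psi.

Definition on_quotient_map (A B : comPzRingType) (f : A -> B) (I : A -> Prop)
    (Prop_ : forall (Q1 Q2 : comPzRingType), (Q1 -> Q2) -> Prop) : Prop :=
  forall (Q1 : comPzRingType) (q1 : A -> Q1) (Q2 : comPzRingType) (q2 : B -> Q2)
         (fb : Q1 -> Q2),
    is_quotient I q1 -> is_quotient (ext_ideal f I) q2 ->
    ring_hom fb -> (forall a, fb (q1 a) = q2 (f a)) ->
    Prop_ Q1 Q2 fb.

(* Main.v *)
(* Flatness enters through the equational criterion modulo an ideal [I]: if [sum r_j s_j] lies in
   [I S], then [s] is an [S]-combination of vectors [c] over [R] with [sum r_j c_j] in [I].  For a
   prime [P] it follows from the stable prime extension property applied to the prime of [R[X]]
   defining the curve [X_i = r_i t] over [kappa_P].  Applying the criterion first modulo [I], then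
   modulo [J] to the values in [I] of the relations found, gives it modulo the intersection of [I]
   and [J]; hence (i) implies (iv).

   For (iii) implies (i), let [Q] be a prime of [R[X]] and [P] a minimal prime of [R] below it.
   Flatness over [R/P] embeds [S[X]/Q S[X] = R[X]/Q (x) S/PS] in [Frac(R[X]/Q) (x) S], which is a
   domain or zero by the hypothesis on the fibers.

   For the statement on fibers, a relation [u v = 0] in [L (x)_R S] involves finitely many elements
   of [L]; they are the images of variables under some [R[X] -> L], and the stable prime extension
   property applies to the kernel of that map. *)
Require Import Defs.
From HB Require Import structures.
From mathcomp Require Import all_boot all_algebra.
From mathcomp Require Import boolp.
From mathcomp Require classical_sets.
From mathcomp Require Import ring.

Set Implicit Arguments.
Unset Strict Implicit.
Unset Printing Implicit Defensive.
Import GRing.Theory.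
Local Open Scope ring_scope.

(** * Ring homomorphisms and ideals *)

(** The prime extension property speaks of products, flatness of linear relations. The bridge is the
    linear form x = sum_i s_i X_i: a relation sum_j r_j s_j in PS puts every r_j x into Q S[X], and
    primality releases x itself. Linear coefficients of elements of Q are usable because their
    constant terms lie in P, which is why the curve passes through the origin instead of being the
    point r. Primality may also release r_j instead of x; then r_j lies in PS, and a second curve
    shows that PS = S unless r_j is in P. Since the objects are given by universal properties, one
    model of each is built as a quotient of formal expressions, and statements about arbitrary
    objects are transferred by uniqueness of maps. In (iii) implies (i) two primes of R have to be
    kept apart: flatness is known modulo a minimal prime P, while the fiber hypothesis is applied at
    the contraction of Q, which may be larger. *)

Section RingHom.
Variables (A B : comPzRingType) (f : A -> B).
Hypothesis hf : ring_hom f.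

Lemma ring_hom1 : f 1 = 1. Proof. by case: hf. Qed.
Lemma ring_homD x y : f (x + y) = f x + f y. Proof. by case: hf => _ h _; apply: h. Qed.
Lemma ring_homM x y : f (x * y) = f x * f y. Proof. by case: hf => _ _; apply. Qed.
Lemma ring_hom0 : f 0 = 0.
Proof. by apply: (addrI (f 0)); rewrite -ring_homD !addr0. Qed.
Lemma ring_homN x : f (- x) = - f x.
Proof. by apply: (addrI (f x)); rewrite -ring_homD !subrr ring_hom0. Qed.
Lemma ring_homB x y : f (x - y) = f x - f y.
Proof. by rewrite ring_homD ring_homN. Qed.
Lemma ring_hom_sum I (r : seq I) (P : pred I) (F : I -> A) :
  f (\sum_(i <- r | P i) F i) = \sum_(i <- r | P i) f (F i).
Proof. by apply: big_morph; [exact: ring_homD | exact: ring_hom0]. Qed.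
Lemma ring_homX x n : f (x ^+ n) = f x ^+ n.
Proof. by elim: n => [|n IH]; rewrite ?expr0 ?ring_hom1 // !exprS ring_homM IH. Qed.

End RingHom.

Lemma ring_hom_id (A : comPzRingType) : ring_hom (@id A).
Proof. by []. Qed.

Lemma ring_hom_comp (A B C : comPzRingType) (f : A -> B) (g : B -> C) :
  ring_hom f -> ring_hom g -> ring_hom (fun x => g (f x)).
Proof.
move=> hf hg; split=> [|x y|x y].
- by rewrite (ring_hom1 hf) (ring_hom1 hg).
- by rewrite (ring_homD hf) (ring_homD hg).
- by rewrite (ring_homM hf) (ring_homM hg).
Qed.

Lemma morph_add0 (A B : zmodType) (f : A -> B) : {morph f : x y / x + y} -> f 0 = 0.
Proof. by move=> h; apply: (addrI (f 0)); rewrite -h !addr0. Qed.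

Lemma morph_addN (A B : zmodType) (f : A -> B) :
  {morph f : x y / x + y} -> {morph f : x / - x}.
Proof. by move=> h x; apply: (addrI (f x)); rewrite -h !subrr morph_add0. Qed.

Lemma morph_add_sum (A B : zmodType) (f : A -> B) : {morph f : x y / x + y} ->
  forall I (r : seq I) (P : pred I) (F : I -> A),
  f (\sum_(i <- r | P i) F i) = \sum_(i <- r | P i) f (F i).
Proof. by move=> h *; apply: big_morph => //; apply: morph_add0. Qed.

Lemma ideal_sum (A : comPzRingType) (I : A -> Prop) : is_ideal I ->
  forall J (r : seq J) (P : pred J) (F : J -> A), (forall j, P j -> I (F j)) ->
  I (\sum_(j <- r | P j) F j).
Proof. by move=> [I0 ID _] J r P F H; apply: big_ind. Qed.

Lemma ideal_opp (A : comPzRingType) (I : A -> Prop) x : is_ideal I -> I x -> I (- x).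
Proof. by move=> [_ _ IM] Ix; rewrite -mulN1r; apply: IM. Qed.

Lemma ideal_mulr (A : comPzRingType) (I : A -> Prop) x y : is_ideal I -> I x -> I (x * y).
Proof. by move=> [_ _ IM] Ix; rewrite mulrC; apply: IM. Qed.

Lemma ideal1_all (A : comPzRingType) (I : A -> Prop) x : is_ideal I -> I 1 -> I x.
Proof. by move=> [_ _ IM] I1; rewrite -(mulr1 x); apply: IM. Qed.

Lemma ideal_ker (A B : comPzRingType) (f : A -> B) : ring_hom f -> is_ideal (fun x => f x = 0).
Proof.
move=> hf; split=> [|x y fx fy|r x fx]; first exact: ring_hom0.
- by rewrite (ring_homD hf) fx fy addr0.
- by rewrite (ring_homM hf) fx mulr0.
Qed.

Lemma ideal_preim (A B : comPzRingType) (f : A -> B) (I : B -> Prop) :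
  ring_hom f -> is_ideal I -> is_ideal (fun x => I (f x)).
Proof.
move=> hf [I0 ID IM]; split=> [|x y Ix Iy|r x Ix]; first by rewrite ring_hom0.
- by rewrite (ring_homD hf); apply: ID.
- by rewrite (ring_homM hf); apply: IM.
Qed.

Lemma prime_preim (A B : comPzRingType) (f : A -> B) (P : B -> Prop) :
  ring_hom f -> prime_ideal P -> prime_ideal (fun x => P (f x)).
Proof.
move=> hf [Pi P1 Pp]; split; first exact: ideal_preim.
- by rewrite ring_hom1.
- by move=> a b; rewrite (ring_homM hf); apply: Pp.
Qed.

Lemma prime_ker (A B : comPzRingType) (f : A -> B) :
  ring_hom f -> is_domain B -> prime_ideal (fun x => f x = 0).
Proof.
move=> hf [B1 Bd]; split; first exact: ideal_ker.
- by rewrite ring_hom1.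
- by move=> a b; rewrite (ring_homM hf); apply: Bd.
Qed.

Lemma field_is_domain (L : fieldType) : is_domain L.
Proof.
split; first by apply/eqP; apply: oner_neq0.
by move=> x y /eqP; rewrite mulf_eq0 => /orP[] /eqP; auto.
Qed.

Lemma In_mem (T : eqType) (x : T) (s : seq T) : List.In x s <-> x \in s.
Proof.
elim: s => //= y s IH; rewrite inE; split.
- by case=> [->|/IH ->]; rewrite ?eqxx ?orbT.
- by case/orP => [/eqP ->|/IH]; auto.
Qed.

Section Ext.
Variables (A B : comPzRingType) (f : A -> B).

Lemma extP (I : A -> Prop) y : ext_ideal f I y <->
  exists (J : finType) (b : J -> B) (a : J -> A),
    (forall j, I (a j)) /\ y = \sum_j b j * f (a j).
Proof.
split.
- case=> l [lI ->]; exists 'I_(size l), (fun j => (tnth (in_tuple l) j).1),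
    (fun j => (tnth (in_tuple l) j).2); split.
  + by move=> j; apply: lI; apply/In_mem; apply: mem_tnth.
  + by rewrite [in LHS](big_tnth _ _ l).
- case=> J [b [a [aI ->]]]; exists [seq (b j, a j) | j <- enum J]; split.
  + by move=> z /In_mem /mapP [j _ ->]; apply: aI.
  + by rewrite big_map big_enum.
Qed.

Lemma ext_ideal_is_ideal (I : A -> Prop) : is_ideal (ext_ideal f I).
Proof.
split.
- by exists [::]; split=> //; rewrite big_nil.
- move=> x y [l1 [h1 ->]] [l2 [h2 ->]]; exists (l1 ++ l2); split.
  + by move=> z /In_mem; rewrite mem_cat => /orP[] /In_mem; [apply: h1 | apply: h2].
  + by rewrite big_cat.
- move=> r x [l [h ->]]; exists [seq (r * z.1, z.2) | z <- l]; split.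
  + by move=> z /In_mem /mapP[w /In_mem hw ->]; apply: (h _ hw).
  + by rewrite big_map mulr_sumr; apply: eq_bigr => z _; rewrite mulrA.
Qed.

Lemma ext_gen (I : A -> Prop) a : I a -> ext_ideal f I (f a).
Proof.
by move=> Ia; exists [:: (1, a)]; split=> [z [<-|//]|]; rewrite // big_seq1 mul1r.
Qed.

Lemma ext_min (I : A -> Prop) (J : B -> Prop) : is_ideal J -> (forall a, I a -> J (f a)) ->
  forall y, ext_ideal f I y -> J y.
Proof.
move=> Ji IJ y /extP[K [b [a [aI ->]]]]; apply: ideal_sum => // j _.
by case: Ji => _ _; apply; apply: IJ.
Qed.

Lemma ext_mono (I J : A -> Prop) : (forall a, I a -> J a) ->
  forall y, ext_ideal f I y -> ext_ideal f J y.
Proof. by move=> IJ; apply: ext_min => [|a /IJ /ext_gen]; first exact: ext_ideal_is_ideal. Qed.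

End Ext.

(** * Quotients by equivalence relations *)

(** Classes are predicates: for an equivalence relation [e], extensionality turns equality of
    classes into [e], and choice supplies representatives, so [e] may be undecidable. *)
Definition quo (X : Type) (e : X -> X -> Prop) := {P : X -> Prop | exists x, P = e x}.
HB.instance Definition _ X e := gen_eqMixin (@quo X e).
HB.instance Definition _ X e := gen_choiceMixin (@quo X e).

(** A group presented by expressions whose laws hold up to [zeqv] only. Quotient rings, polynomial
    rings, tensor products and residue fields all arise from such data. *)
Record zraw := ZRaw {
  zcar : Type; zeqv : zcar -> zcar -> Prop;
  zzero : zcar; zadd : zcar -> zcar -> zcar; zopp : zcar -> zcar;
  zrefl : forall x, zeqv x x;
  zsym : forall x y, zeqv x y -> zeqv y x;
  ztrans : forall x y z, zeqv x y -> zeqv y z -> zeqv x z;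
  zaddE : forall x x' y y', zeqv x x' -> zeqv y y' -> zeqv (zadd x y) (zadd x' y');
  zoppE : forall x x', zeqv x x' -> zeqv (zopp x) (zopp x');
  zaddA : forall x y z, zeqv (zadd x (zadd y z)) (zadd (zadd x y) z);
  zaddC : forall x y, zeqv (zadd x y) (zadd y x);
  zadd0 : forall x, zeqv (zadd zzero x) x;
  zaddN : forall x, zeqv (zadd (zopp x) x) zzero }.

Record rraw := RRaw {
  rzraw : zraw;
  rone : zcar rzraw; rmul : zcar rzraw -> zcar rzraw -> zcar rzraw;
  rmulE : forall x x' y y', zeqv x x' -> zeqv y y' -> zeqv (rmul x y) (rmul x' y');
  rmulA : forall x y z, zeqv (rmul x (rmul y z)) (rmul (rmul x y) z);
  rmulC : forall x y, zeqv (rmul x y) (rmul y x);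
  rmul1 : forall x, zeqv (rmul rone x) x;
  rmulD : forall x y z, zeqv (rmul (zadd x y) z) (zadd (rmul x z) (rmul y z)) }.

Section ZQuo.
Variable r : zraw.

Definition zquo := quo (@zeqv r).
HB.instance Definition _ := Choice.on zquo.

Definition zpi (x : zcar r) : zquo := exist _ (zeqv x) (ex_intro _ x erefl).
Definition zrepr (q : zquo) : zcar r := sval (cid (proj2_sig q)).

Lemma zreprK q : zpi (zrepr q) = q.
Proof.
case: q => P hP; rewrite /zrepr /zpi; apply: eq_exist; case: cid => x /= ->.
by [].
Qed.

Lemma zpiP x y : zpi x = zpi y <-> zeqv x y.
Proof.
split=> [[e]|e]; first by rewrite e; apply: zrefl.
apply: eq_exist; apply: funext => z /=; apply: propext; split.
- by apply: ztrans; apply: zsym.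
- exact: ztrans.
Qed.

Lemma zrepr_pi x : zeqv (zrepr (zpi x)) x.
Proof. by apply/zpiP; rewrite zreprK. Qed.

Lemma zquo_ind (P : zquo -> Prop) : (forall x, P (zpi x)) -> forall q, P q.
Proof. by move=> h q; rewrite -(zreprK q). Qed.

Definition zq_add (p q : zquo) := zpi (zadd (zrepr p) (zrepr q)).
Definition zq_opp (p : zquo) := zpi (zopp (zrepr p)).

Lemma zq_addE x y : zq_add (zpi x) (zpi y) = zpi (zadd x y).
Proof. by apply/zpiP; apply: zaddE; apply: zrepr_pi. Qed.
Lemma zq_oppE x : zq_opp (zpi x) = zpi (zopp x).
Proof. by apply/zpiP; apply: zoppE; apply: zrepr_pi. Qed.

Lemma zq_addA : associative zq_add.
Proof.
elim/zquo_ind=> x; elim/zquo_ind=> y; elim/zquo_ind=> z.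
by rewrite !zq_addE; apply/zpiP; apply: zaddA.
Qed.
Lemma zq_addC : commutative zq_add.
Proof.
by elim/zquo_ind=> x; elim/zquo_ind=> y; rewrite !zq_addE; apply/zpiP; apply: zaddC.
Qed.
Lemma zq_add0 : left_id (zpi (zzero r)) zq_add.
Proof. by elim/zquo_ind=> x; rewrite !zq_addE; apply/zpiP; apply: zadd0. Qed.
Lemma zq_addN : left_inverse (zpi (zzero r)) zq_opp zq_add.
Proof. by elim/zquo_ind=> x; rewrite !zq_oppE !zq_addE; apply/zpiP; apply: zaddN. Qed.

HB.instance Definition _ := GRing.isZmodule.Build zquo zq_addA zq_addC zq_add0 zq_addN.

Lemma zpiD x y : zpi (zadd x y) = zpi x + zpi y.
Proof. by rewrite -zq_addE. Qed.
Lemma zpi_eq0 x : zpi x = 0 <-> zeqv x (zzero r).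
Proof. exact: zpiP. Qed.

End ZQuo.
Arguments zpi : clear implicits.

Section RQuo.
Variable r : rraw.
Definition rquo := zquo (rzraw r).
HB.instance Definition _ := GRing.Zmodule.on rquo.
Definition rpi (x : zcar (rzraw r)) : rquo := zpi (rzraw r) x.

Definition rq_mul (p q : rquo) : rquo := rpi (rmul (zrepr p) (zrepr q)).
Lemma rq_mulE x y : rq_mul (rpi x) (rpi y) = rpi (rmul x y).
Proof. by apply/zpiP; apply: rmulE; apply: zrepr_pi. Qed.

Lemma rquo_ind (P : rquo -> Prop) : (forall x, P (rpi x)) -> forall q, P q.
Proof. exact: zquo_ind. Qed.
Lemma rpiP x y : rpi x = rpi y <-> zeqv x y.
Proof. exact: zpiP. Qed.
Lemma rpiD x y : rpi (zadd x y) = rpi x + rpi y.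
Proof. exact: zpiD. Qed.
Lemma rq_mulA : associative rq_mul.
Proof.
elim/rquo_ind=> x; elim/rquo_ind=> y; elim/rquo_ind=> z.
by rewrite !rq_mulE; apply/rpiP; exact: rmulA.
Qed.
Lemma rq_mulC : commutative rq_mul.
Proof.
by elim/rquo_ind=> x; elim/rquo_ind=> y; rewrite !rq_mulE; apply/rpiP; exact: rmulC.
Qed.
Lemma rq_mul1 : left_id (rpi (rone r)) rq_mul.
Proof. by elim/rquo_ind=> x; rewrite !rq_mulE; apply/rpiP; exact: rmul1. Qed.
Lemma rq_mulD : left_distributive rq_mul +%R.
Proof.
elim/rquo_ind=> x; elim/rquo_ind=> y; elim/rquo_ind=> z.
by rewrite -rpiD !rq_mulE -rpiD; apply/rpiP; exact: rmulD.
Qed.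
HB.instance Definition _ :=
  GRing.Zmodule_isComPzRing.Build rquo rq_mulA rq_mulC rq_mul1 rq_mulD.

Lemma rpiM x y : rpi (rmul x y) = rpi x * rpi y.
Proof. by rewrite -rq_mulE. Qed.
Lemma rpi1 : rpi (rone r) = 1. Proof. by []. Qed.
Lemma rpi_eq0 x : rpi x = 0 <-> zeqv x (zzero _).
Proof. exact: zpiP. Qed.

End RQuo.

Section QuotientRing.
Variables (A : comPzRingType) (I : A -> Prop).
Hypothesis Ii : is_ideal I.

Definition quot_zraw : zraw.
Proof.
refine (@ZRaw A (fun x y => I (x - y)) 0 +%R (@GRing.opp A) _ _ _ _ _ _ _ _ _);
  have [I0 ID IM] := Ii.
- by move=> x /=; rewrite subrr.
- by move=> x y h; rewrite -opprB; apply: ideal_opp.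
- move=> x y z h1 h2; have -> : x - z = (x - y) + (y - z) by ring.
  by apply: ID.
- move=> x x' y y' h1 h2; have -> : x + y - (x' + y') = (x - x') + (y - y') by ring.
  exact: ID.
- move=> x x' h; have -> : - x - - x' = - (x - x') by ring.
  by apply: ideal_opp.
- by move=> x y z /=; rewrite addrA subrr.
- by move=> x y /=; rewrite (addrC x) subrr.
- by move=> x /=; rewrite add0r subrr.
- by move=> x /=; rewrite addNr subrr.
Defined.

Definition quot_rraw : rraw.
Proof.
refine (@RRaw quot_zraw (1 : A) ( *%R : A -> A -> A) _ _ _ _ _); have [I0 ID IM] := Ii.
- move=> x x' y y' h1 h2 /=.
  have -> : x * y - x' * y' = y * (x - x') + x' * (y - y') by ring.
  by apply: ID; apply: IM.
- by move=> x y z /=; rewrite mulrA subrr.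
- by move=> x y /=; rewrite (mulrC x) subrr.
- by move=> x /=; rewrite mul1r subrr.
- by move=> x y z /=; rewrite mulrDl subrr.
Defined.

Lemma quotient_exists : exists (Q : comPzRingType) (q : A -> Q), is_quotient I q.
Proof.
exists (rquo quot_rraw), (@rpi quot_rraw); split.
- split; [exact: rpi1 | exact: (@rpiD quot_rraw) | exact: (@rpiM quot_rraw)].
- by elim/rquo_ind=> x; exists x.
- by move=> x; rewrite (@rpi_eq0 quot_rraw) /= subr0.
Qed.

End QuotientRing.

Section QuotientUP.
Variables (A : comPzRingType) (I : A -> Prop) (Q : comPzRingType) (q : A -> Q).
Hypothesis hq : is_quotient I q.

Lemma quotient_lift_sig (D : zmodType) (u : A -> D) :
  {morph u : x y / x + y} -> (forall x, I x -> u x = 0) ->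
  exists w : Q -> D, forall x, w (q x) = u x.
Proof.
move=> uD uI; have [qh qs qI] := hq.
exists (fun z => u (sval (cid (qs z)))) => x; case: cid => y /= e.
apply/eqP; rewrite -subr_eq0 -(morph_addN uD) -uD; apply/eqP/uI/qI.
by rewrite (ring_homB qh) e subrr.
Qed.

Lemma quotient_lift (D : comPzRingType) (u : A -> D) :
  ring_hom u -> (forall x, I x -> u x = 0) ->
  exists w : Q -> D, ring_hom w /\ forall x, w (q x) = u x.
Proof.
move=> uh uI; have [qh qs qI] := hq.
have [w hw] := quotient_lift_sig (ring_homD uh) uI.
exists w; split=> //; split.
- by rewrite -(ring_hom1 qh) hw ring_hom1.
- move=> x y; have [x' <-] := qs x; have [y' <-] := qs y.
  by rewrite -(ring_homD qh) !hw (ring_homD uh).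
- move=> x y; have [x' <-] := qs x; have [y' <-] := qs y.
  by rewrite -(ring_homM qh) !hw (ring_homM uh).
Qed.

Lemma quotient_eq x y : q x = q y <-> I (x - y).
Proof.
have [qh qs qI] := hq; rewrite -qI (ring_homB qh); split=> [->|/eqP]; first exact: subrr.
by rewrite subr_eq0 => /eqP.
Qed.


End QuotientUP.

(** * Polynomial rings *)

Section PolyRing.
Variables (n : nat) (A : comPzRingType).

Inductive pterm := PConst of A | PVar of 'I_n | PAdd of pterm & pterm | PMul of pterm & pterm.

Fixpoint peval (D : comPzRingType) (u : A -> D) (y : 'I_n -> D) (t : pterm) : D :=
  match t with
  | PConst a => u a
  | PVar i => y i
  | PAdd s t => peval u y s + peval u y t
  | PMul s t => peval u y s * peval u y t
  end.

(** Terms are identified when no evaluation in any ring separates them. The ring laws are then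
    inherited from the target rings, and evaluation descends to classes without any normal form. *)
Definition peqv (s t : pterm) : Prop :=
  forall (D : comPzRingType) (u : A -> D) (y : 'I_n -> D), ring_hom u ->
  peval u y s = peval u y t.

Definition poly_zraw : zraw.
Proof.
refine (@ZRaw pterm peqv (PConst 0) PAdd (PMul (PConst (- 1))) _ _ _ _ _ _ _ _ _).
- by [].
- by move=> s t h D u y hu; rewrite h.
- by move=> s t v h1 h2 D u y hu; rewrite h1 ?h2.
- by move=> s s' t t' h1 h2 D u y hu /=; rewrite h1 ?h2.
- by move=> s s' h D u y hu /=; rewrite h.
- by move=> s t v D u y hu /=; rewrite addrA.
- by move=> s t D u y hu /=; rewrite addrC.
- by move=> s D u y hu /=; rewrite (ring_hom0 hu) add0r.
- by move=> s D u y hu /=; rewrite (ring_homN hu) (ring_hom1 hu) (ring_hom0 hu) mulN1r addNr.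
Defined.

Definition poly_rraw : rraw.
Proof.
refine (@RRaw poly_zraw (PConst 1) PMul _ _ _ _ _).
- by move=> s s' t t' h1 h2 D u y hu /=; rewrite h1 ?h2.
- by move=> s t v D u y hu /=; rewrite mulrA.
- by move=> s t D u y hu /=; rewrite mulrC.
- by move=> s D u y hu /=; rewrite (ring_hom1 hu) mul1r.
- by move=> s t v D u y hu /=; rewrite mulrDl.
Defined.

Definition polyc (a : A) : rquo poly_rraw := rpi (r := poly_rraw) (PConst a).
Definition polyX (i : 'I_n) : rquo poly_rraw := rpi (r := poly_rraw) (PVar i).

Lemma polyc_hom : ring_hom polyc.
Proof.
split=> // x y.
- by rewrite -rpiD; apply/rpiP => D u z hu /=; rewrite (ring_homD hu).
- by rewrite -rpiM; apply/rpiP => D u z hu /=; rewrite (ring_homM hu).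
Qed.

Lemma poly_rquo_ind (Pr : rquo poly_rraw -> Prop) :
  (forall a, Pr (polyc a)) -> (forall i, Pr (polyX i)) ->
  (forall x y, Pr x -> Pr y -> Pr (x + y)) ->
  (forall x y, Pr x -> Pr y -> Pr (x * y)) -> forall x, Pr x.
Proof.
move=> hc hX hD hM; elim/rquo_ind; elim=> [a|i|s hs t ht|s hs t ht].
- exact: hc.
- exact: hX.
- by rewrite -[PAdd s t]/(@zadd (rzraw poly_rraw) s t) rpiD; apply: hD.
- by rewrite -[PMul s t]/(@rmul poly_rraw s t) rpiM; apply: hM.
Qed.

Lemma polyring_rquo : is_polyring polyc polyX.
Proof.
split; first exact: polyc_hom.
move=> D u y hu.
have wE t : peval u y (zrepr (rpi (r := poly_rraw) t)) = peval u y t.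
  exact: (zrepr_pi (r := poly_zraw) t).
exists (fun x : rquo poly_rraw => peval u y (zrepr x)); split.
- split; last 2 first.
  + by move=> a; rewrite wE.
  + by move=> i; rewrite wE.
  split.
  + by rewrite -rpi1 wE /= (ring_hom1 hu).
  + by elim/rquo_ind=> s; elim/rquo_ind=> t; rewrite -rpiD !wE.
  + by elim/rquo_ind=> s; elim/rquo_ind=> t; rewrite -rpiM !wE.
- move=> w [hw wc wX]; apply: funext; elim/poly_rquo_ind => [a|i|x z hx hz|x z hx hz].
  + by rewrite wE wc.
  + by rewrite wE wX.
  + rewrite (ring_homD hw) -hx -hz; clear hx hz; move: x z.
    by elim/rquo_ind=> s; elim/rquo_ind=> t; rewrite -rpiD !wE.
  + rewrite (ring_homM hw) -hx -hz; clear hx hz; move: x z.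
    by elim/rquo_ind=> s; elim/rquo_ind=> t; rewrite -rpiM !wE.
Qed.

End PolyRing.

Lemma polyring_exists (n : nat) (A : comPzRingType) :
  exists (P : comPzRingType) (c : A -> P) (X : 'I_n -> P), is_polyring c X.
Proof. by do 3!eexists; apply: polyring_rquo. Qed.

Section PolyRingTheory.
Variables (n : nat) (A P : comPzRingType) (c : A -> P) (X : 'I_n -> P).
Hypothesis hP : is_polyring c X.

Lemma polyring_hom : ring_hom c. Proof. by case: hP. Qed.

Lemma polyring_map (D : comPzRingType) (u : A -> D) (y : 'I_n -> D) : ring_hom u ->
  exists w : P -> D, [/\ ring_hom w, (forall a, w (c a) = u a) & (forall i, w (X i) = y i)].
Proof. by move=> hu; case: hP => _ /(_ D u y hu) [w [hw _]]; exists w. Qed.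

Lemma polyring_ext (D : comPzRingType) (w w' : P -> D) : ring_hom w -> ring_hom w' ->
  (forall a, w (c a) = w' (c a)) -> (forall i, w (X i) = w' (X i)) -> w =1 w'.
Proof.
move=> hw hw' ec eX x; have hc := polyring_hom.
case: hP => _ /(_ D _ (fun i => w (X i)) (ring_hom_comp hc hw)) [v [_ vu]].
have e : v = w' by apply: vu; split=> // *; rewrite ?ec ?eX.
by rewrite -e (vu w).
Qed.

(** The round trip from [P] to the term model and back is the identity by [polyring_ext], so every
    element of [P] is the value of a term. *)
Lemma polyring_ind (Pr : P -> Prop) :
  (forall a, Pr (c a)) -> (forall i, Pr (X i)) ->
  (forall x y, Pr x -> Pr y -> Pr (x + y)) ->
  (forall x y, Pr x -> Pr y -> Pr (x * y)) -> forall x, Pr x.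
Proof.
move=> pc pX pD pM x.
have [_ /(_ _ _ X polyring_hom) [v [[hv vc vX] _]]] := polyring_rquo n A.
have [w [hw wc wX]] := polyring_map (polyX A (n:=n)) (@polyc_hom n A).
rewrite -[x](@polyring_ext _ (fun x => v (w x)) id) //.
- elim/poly_rquo_ind: (w x) => [a|i|y z hy hz|y z hy hz].
  + by rewrite vc.
  + by rewrite vX.
  + by rewrite (ring_homD hv); apply: pD.
  + by rewrite (ring_homM hv); apply: pM.
- exact: ring_hom_comp.
- by move=> a; rewrite wc vc.
- by move=> i; rewrite wX vX.
Qed.

End PolyRingTheory.

(** * Tensor products *)

Section Tensor.
Variables (A B : comPzRingType) (f : A -> B) (M : lmodType A).

Definition bsum (N : zmodType) (g : M -> B -> N) (l : seq (M * B)) : N :=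
  \sum_(z <- l) g z.1 z.2.

(* Formal sums are identified when every balanced map does so; this impredicative congruence
   makes the universal property immediate. *)
Definition teqv (l l' : seq (M * B)) : Prop :=
  forall (N : zmodType) (g : M -> B -> N), balanced f g -> bsum g l = bsum g l'.

Lemma balancedN (N : zmodType) (g : M -> B -> N) m y : balanced f g -> g m (- y) = - g m y.
Proof. by move=> [_ gD _]; apply: (morph_addN (f := g m)) => ? ?; apply: gD. Qed.

Lemma bsum_cat (N : zmodType) (g : M -> B -> N) l l' :
  bsum g (l ++ l') = bsum g l + bsum g l'.
Proof. by rewrite /bsum big_cat. Qed.

Definition negl (l : seq (M * B)) := [seq (z.1, - z.2) | z <- l].

Lemma bsum_neg (N : zmodType) (g : M -> B -> N) l :
  balanced f g -> bsum g (negl l) = - bsum g l.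
Proof.
by move=> hg; rewrite /bsum big_map -sumrN; apply: eq_bigr => z _; rewrite balancedN.
Qed.

Definition tensor_zraw : zraw.
Proof.
refine (@ZRaw (seq (M * B)) teqv [::] cat negl _ _ _ _ _ _ _ _ _).
- by [].
- by move=> s t h N g hg; rewrite h.
- by move=> s t v h1 h2 N g hg; rewrite h1 ?h2.
- by move=> s s' t t' h1 h2 N g hg; rewrite !bsum_cat h1 ?h2.
- by move=> s s' h N g hg; rewrite !bsum_neg ?h.
- by move=> s t v N g hg; rewrite !bsum_cat addrA.
- by move=> s t N g hg; rewrite !bsum_cat addrC.
- by [].
- by move=> s N g hg; rewrite bsum_cat bsum_neg // addNr /bsum big_nil.
Defined.

Definition tensor : zmodType := zquo tensor_zraw.
Definition tclass (l : seq (M * B)) : tensor := zpi tensor_zraw l.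
Definition tpure (m : M) (y : B) : tensor := tclass [:: (m, y)].

Lemma tclassP l l' : tclass l = tclass l' <-> teqv l l'.
Proof. exact: (@zpiP tensor_zraw). Qed.

Lemma tclassE l : tclass l = bsum tpure l.
Proof.
elim: l => [|[m y] l IH]; first by rewrite /bsum big_nil.
by rewrite /bsum big_cons -/(bsum tpure l) -IH -[tpure _ _ + _]zpiD.
Qed.

Lemma tensor_ind (Pr : tensor -> Prop) : (forall l, Pr (tclass l)) -> forall x, Pr x.
Proof. exact: (@zquo_ind tensor_zraw). Qed.

Lemma tensor_is_tensor : is_tensor_mod f tpure.
Proof.
split; first split.
- move=> m m' y; rewrite -[RHS]zpiD; apply/tclassP => N g [gD _ _].
  by rewrite /bsum !big_cons !big_nil /= gD !addr0.
- move=> m y y'; rewrite -[RHS]zpiD; apply/tclassP => N g [_ gD _].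
  by rewrite /bsum !big_cons !big_nil /= gD !addr0.
- move=> a m y; apply/tclassP => N g [_ _ gA].
  by rewrite /bsum !big_cons !big_nil /= gA.
move=> N g hg.
have wE l : bsum g (zrepr (tclass l)) = bsum g l.
  exact: (zrepr_pi (r := tensor_zraw) l).
exists (fun x : tensor => bsum g (zrepr x)); split; first split.
- by elim/tensor_ind=> l; elim/tensor_ind=> l'; rewrite -[_ + _]zpiD !wE bsum_cat.
- by move=> m y; rewrite wE /bsum big_seq1.
- move=> w [wD wp]; apply: funext; elim/tensor_ind=> l.
  rewrite wE tclassE /bsum (morph_add_sum wD).
  by apply: eq_bigr => z _; rewrite wp.
Qed.

End Tensor.

Section TensorMod.
Variables (A B : comPzRingType) (f : A -> B) (M : lmodType A).
Variables (T : zmodType) (t : M -> B -> T).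
Hypothesis ht : is_tensor_mod f t.

Lemma tensor_mod_lift (N : zmodType) (g : M -> B -> N) : balanced f g ->
  exists u : T -> N, {morph u : x y / x + y} /\ forall m y, u (t m y) = g m y.
Proof. by move=> hg; case: ht => _ /(_ N g hg) [u [hu _]]; exists u. Qed.

(** The round trip from [T] to the model [tensor] and back is the identity by uniqueness, and in the
    model every element is the class of a formal sum. *)
Lemma tensor_mod_span (x : T) : exists l : seq (M * B), x = bsum t l.
Proof.
have [u [uD ut]] := tensor_mod_lift (tensor_is_tensor f M).1.
have [bt tu] := ht.
have [_ /(_ T t bt) [v [[vD vt] _]]] := tensor_is_tensor f M.
have [w [_ wu]] := tu T t bt.
have vu : (fun x => v (u x)) = id.
  rewrite -(wu (fun x => v (u x))) ?(wu id) //.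
  by split=> [a b|m y]; rewrite ?uD ?vD // ut vt.
have -> : x = v (u x) by rewrite -[LHS]/(id x) -vu.
elim/tensor_ind: (u x) => l; exists l; rewrite tclassE /bsum (morph_add_sum vD).
by apply: eq_bigr => z _; rewrite vt.
Qed.

Lemma tensor_mod_eq0 l : bsum t l = 0 ->
  forall (N : zmodType) (g : M -> B -> N), balanced f g -> bsum g l = 0.
Proof.
move=> e N g hg; have [u [uD ut]] := tensor_mod_lift hg.
rewrite -(morph_add0 uD) -e /bsum (morph_add_sum uD).
by apply: eq_bigr => z _; rewrite ut.
Qed.

End TensorMod.

(** * Tensor products of algebras *)

Section AlgMod.
Variables (A C : comPzRingType) (g : A -> C).
Hypothesis hg : ring_hom g.

(** The phantom argument keeps [g] in the type, so that one ring [C] can carry several [A]-module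
    structures. *)
Definition algmod of ring_hom g : Type := C.
HB.instance Definition _ := GRing.Zmodule.on (algmod hg).

Fact algmod_scaleA a b (x : algmod hg) : g a * (g b * x) = g (a * b) * x :> C.
Proof. by rewrite (ring_homM hg) mulrA. Qed.
Fact algmod_scale1 (x : algmod hg) : g 1 * x = x :> C.
Proof. by rewrite (ring_hom1 hg) mul1r. Qed.
Fact algmod_scaleDr (a : A) (x y : algmod hg) :
  g a * ((x + y : algmod hg) : C) = (g a * x + g a * y : C).
Proof. exact: mulrDr. Qed.
Fact algmod_scaleDl (x : algmod hg) (a b : A) : g (a + b) * x = g a * x + g b * x :> C.
Proof. by rewrite (ring_homD hg) mulrDl. Qed.
HB.instance Definition _ := GRing.Zmodule_isLmodule.Build A (algmod hg)
  algmod_scaleA algmod_scale1 algmod_scaleDr algmod_scaleDl.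

Lemma algmod_scaleE a (x : algmod hg) : a *: x = g a * (x : C) :> C.
Proof. by []. Qed.

End AlgMod.

Section TensorRing.
Variables (A B C : comPzRingType) (f : A -> B) (g : A -> C).
Hypotheses (hf : ring_hom f) (hg : ring_hom g).

Let M : lmodType A := algmod hg.

Definition mull (l l' : seq (M * B)) : seq (M * B) :=
  [seq ((z.1 : C) * (z'.1 : C) : M, z.2 * z'.2) | z <- l, z' <- l'].

Lemma bsum_mull (N : zmodType) (p : M -> B -> N) l l' :
  bsum p (mull l l') = \sum_(z <- l) \sum_(z' <- l') p ((z.1 : C) * (z'.1 : C) : M) (z.2 * z'.2).
Proof. by rewrite /bsum /mull big_allpairs_dep. Qed.

Lemma mullC l l' : teqv f (mull l l') (mull l' l).
Proof.
move=> N p hp; rewrite !bsum_mull exchange_big; apply: eq_bigr => z _.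
by apply: eq_bigr => z' _; rewrite mulrC (mulrC z.2).
Qed.

(** Multiplying by a fixed formal sum turns a balanced map into a balanced map, against which [l1]
    and [l2] can be compared. *)
Lemma mull_congr l1 l2 l : teqv f l1 l2 -> teqv f (mull l1 l) (mull l2 l).
Proof.
move=> h N p [pD pD' pA]; rewrite !bsum_mull.
apply: (h N (fun m y => \sum_(z' <- l) p ((m : C) * (z'.1 : C) : M) (y * z'.2))).
split=> [m m' y|m y y'|a m y]; rewrite -?big_split; apply: eq_bigr => z _.
- by rewrite mulrDl pD.
- by rewrite mulrDl pD'.
- by rewrite -mulrA -pA !algmod_scaleE mulrA.
Qed.

Definition tensor_rraw : rraw.
Proof.
refine (@RRaw (tensor_zraw f M) [:: ((1 : C) : M, 1)] mull _ _ _ _ _).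
- move=> x x' y y' h1 h2; move=> N p hp; rewrite (mull_congr _ h1) //.
  by rewrite mullC // (mull_congr _ h2) // mullC.
- move=> x y z N p hp; rewrite !bsum_mull /mull [RHS]big_allpairs_dep; apply: eq_bigr => u _.
  rewrite big_allpairs_dep; apply: eq_bigr => v _; apply: eq_bigr => w _.
  by rewrite /= !mulrA.
- exact: mullC.
- move=> x N p hp; rewrite bsum_mull big_seq1; apply: eq_bigr => z _ /=.
  by rewrite !mul1r.
- by move=> x y z N p hp; rewrite bsum_cat !bsum_mull big_cat.
Defined.

Definition tring : comPzRingType := rquo tensor_rraw.
Definition tring_pure (c : C) (b : B) : tring := rpi (r := tensor_rraw) [:: (c : M, b)].

(** The additive group of [tring] is the model [tensor] by definition. Having one object for both
    universal properties lets flatness, a statement on modules, act on maps of rings. *)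
Lemma tring_mod : is_tensor_mod f (tring_pure : M -> B -> tring).
Proof. exact: tensor_is_tensor. Qed.

Lemma tring_pureM c c' b b' : tring_pure c b * tring_pure c' b' = tring_pure (c * c') (b * b').
Proof. by rewrite -rpiM; apply/rpiP. Qed.

Lemma tring_span (x : tring) : exists l : seq (C * B), x = \sum_(z <- l) tring_pure z.1 z.2.
Proof. exact: (tensor_mod_span tring_mod). Qed.

Lemma tring_is_tensor_alg :
  is_tensor_alg g f (fun c => tring_pure c 1) (fun b => tring_pure 1 b).
Proof.
have [[bD bD' bA] up] := tring_mod.
have hi : ring_hom (fun c => tring_pure c 1).
  split=> [//|x y|x y]; first exact: bD.
  by rewrite tring_pureM mulr1.
have hj : ring_hom (fun b => tring_pure 1 b).
  split=> [//|x y|x y]; first exact: bD'.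
  by rewrite tring_pureM mulr1.
split=> //.
- move=> a; have := bA a (1 : C) 1; rewrite !mulr1.
  by rewrite algmod_scaleE mulr1.
move=> D u v hu hv huv.
have bal : balanced f (fun (m : M) y => u (m : C) * v y).
  split=> [m m' y|m y y'|a m y].
  - by rewrite (ring_homD hu) mulrDl.
  - by rewrite (ring_homD hv) mulrDr.
  - by rewrite algmod_scaleE (ring_homM hu) (ring_homM hv) huv; ring.
have [w [[wD wE] wu]] := up _ _ bal; exists w; split; first split.
- split=> //; first by rewrite -[1]/(tring_pure 1 1) wE (ring_hom1 hu) (ring_hom1 hv) mulr1.
  move=> x y; have [lx ->] := tring_span x; have [ly ->] := tring_span y.
  rewrite mulr_suml !(morph_add_sum wD) mulr_suml; apply: eq_bigr => z _.
  rewrite mulr_sumr (morph_add_sum wD) mulr_sumr; apply: eq_bigr => z' _.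
  rewrite tring_pureM !wE (ring_homM hu) (ring_homM hv); ring.
- by move=> b; rewrite wE (ring_hom1 hv) mulr1.
- by move=> b; rewrite wE (ring_hom1 hu) mul1r.
move=> w' [hw' w'i w'j]; apply: wu; split; first exact: ring_homD.
move=> m y; have -> : tring_pure m y = tring_pure m 1 * tring_pure 1 y.
  by rewrite tring_pureM mulr1 mul1r.
by rewrite (ring_homM hw') w'i w'j.
Qed.

End TensorRing.
(** * Residue fields *)

Section ResidueField.
Variables (A : comPzRingType) (P : A -> Prop).
Hypothesis Pp : prime_ideal P.

Let den := {b : A | ~ P b}.
Let den1 : den := exist _ 1 (let: And3 _ h _ := Pp in h).
Let den_mul (b d : den) : den.
Proof.
exists (sval b * sval d); case: b d => [b hb] [d hd] /=.
by case: Pp => _ _ /(_ b d) h /h [].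
Defined.

Lemma prime_cancel b x : ~ P b -> P (b * x) -> P x.
Proof. by case: Pp => _ _ h hb /h []. Qed.

(** Fractions with denominator outside [P], with cross-multiplication tested modulo [P]. This yields
    A_P/PA_P in one step; primality of [P] makes the relation transitive. *)
Let feqv (x y : A * den) := P (x.1 * sval y.2 - y.1 * sval x.2).

Let P0 x : x = 0 -> P x.
Proof. by move=> ->; case: Pp => -[]. Qed.

Definition res_zraw : zraw.
Proof.
refine (@ZRaw (A * den) feqv (0, den1)
  (fun x y => (x.1 * sval y.2 + y.1 * sval x.2, den_mul x.2 y.2))
  (fun x => (- x.1, x.2)) _ _ _ _ _ _ _ _ _); rewrite /feqv;
  have [[_ PD PM] _ _] := Pp.
- by move=> x; rewrite subrr; apply: P0.
- by move=> x y h; rewrite -opprB; apply: ideal_opp h; case: Pp.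
- move=> x [y [d hd]] z h1 h2; apply: (prime_cancel hd).
  have -> : d * (x.1 * sval z.2 - z.1 * sval x.2) =
    sval z.2 * (x.1 * d - y * sval x.2) + sval x.2 * (y * sval z.2 - z.1 * d) by ring.
  by apply: PD; apply: PM.
- move=> x x' y y' h1 h2 /=.
  set l := (X in P X).
  have -> : l = sval y.2 * sval y'.2 * (x.1 * sval x'.2 - x'.1 * sval x.2) +
      sval x.2 * sval x'.2 * (y.1 * sval y'.2 - y'.1 * sval y.2) by rewrite /l; ring.
  by apply: PD; apply: PM.
- move=> x x' h /=.
  have -> : - x.1 * sval x'.2 - - x'.1 * sval x.2 =
    -1 * (x.1 * sval x'.2 - x'.1 * sval x.2) by ring.
  exact: PM.
- by move=> x y z /=; apply: P0; ring.
- by move=> x y /=; apply: P0; ring.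
- by move=> x /=; apply: P0; ring.
- by move=> x /=; apply: P0; ring.
Defined.

Definition res_rraw : rraw.
Proof.
refine (@RRaw res_zraw (1, den1) (fun x y => (x.1 * y.1, den_mul x.2 y.2)) _ _ _ _ _);
  have [[_ PD PM] _ _] := Pp.
- move=> x x' y y' h1 h2; rewrite /= /feqv /=.
  set l := (X in P X).
  have -> : l = y.1 * sval y'.2 * (x.1 * sval x'.2 - x'.1 * sval x.2) +
      sval x.2 * x'.1 * (y.1 * sval y'.2 - y'.1 * sval y.2) by rewrite /l; ring.
  by apply: PD; apply: PM.
- by move=> x y z /=; apply: P0 => /=; ring.
- by move=> x y /=; apply: P0 => /=; ring.
- by move=> x /=; apply: P0 => /=; ring.
- by move=> x y z /=; apply: P0 => /=; ring.
Defined.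

Definition resring := rquo res_rraw.
HB.instance Definition _ := GRing.ComPzRing.on resring.

Fact resring_neq0 : (1 : resring) != 0.
Proof.
apply/eqP; rewrite -rpi1 rpi_eq0 /= /feqv /= mulr1 mul0r subr0.
by case: Pp.
Qed.
HB.instance Definition _ := GRing.PzSemiRing_isNonZero.Build resring resring_neq0.

Fact resring_inv_ex (x : resring) : x != 0 -> exists y : resring, y * x = 1.
Proof.
elim/rquo_ind: x => -[a d] /eqP; rewrite rpi_eq0 /= /feqv /= mulr1 mul0r subr0 => ha.
exists (rpi (r := res_rraw) (sval d, exist _ a ha)).
by rewrite -rpiM -rpi1; apply/rpiP; apply: P0 => /=; ring.
Qed.

Definition resring_inv (x : resring) : resring :=
  if pselect (x != 0) is left h then sval (cid (resring_inv_ex h)) else 0.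
Fact resring_mulVf x : x != 0 -> resring_inv x * x = 1.
Proof. by rewrite /resring_inv; case: pselect => // h _; case: cid. Qed.
Fact resring_inv0 : resring_inv 0 = 0.
Proof. by rewrite /resring_inv; case: pselect => // h; case/eqP: {+}h. Qed.
HB.instance Definition _ := GRing.ComNzRing_isField.Build resring resring_mulVf resring_inv0.

Definition res_map (a : A) : resring := rpi (r := res_rraw) (a, den1).

Lemma res_map_hom : ring_hom res_map.
Proof.
split=> // x y.
- by rewrite -[RHS]rpiD; apply/rpiP; apply: P0 => /=; ring.
- by rewrite -[RHS]rpiM; apply/rpiP; apply: P0 => /=; ring.
Qed.

Lemma res_map_eq0 a : res_map a = 0 <-> P a.
Proof. by rewrite rpi_eq0 /= /feqv /= mulr1 mul0r subr0. Qed.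

Lemma res_map_frac (x : resring) : exists a b, ~ P b /\ x * res_map b = res_map a.
Proof.
elim/rquo_ind: x => -[a [b hb]]; exists a, b; split=> //.
by rewrite -[LHS]rpiM; apply/rpiP; apply: P0 => /=; ring.
Qed.

Lemma res_map_unit a : ~ P a -> unitP (res_map a).
Proof.
move=> ha; have /resring_inv_ex [y hy] : res_map a != 0 by apply/eqP => /res_map_eq0.
by exists y; rewrite mulrC.
Qed.

Lemma unitP_reg (D : comPzRingType) (d x y : D) : unitP d -> x * d = y * d -> x = y.
Proof. by move=> [e he] h; rewrite -[x]mulr1 -he mulrA h -mulrA he mulr1. Qed.

Lemma res_map_residue : is_residue_field P res_map.
Proof.
split; [exact: res_map_hom | by move=> a /res_map_eq0 | exact: res_map_unit |].
move=> D u hu uP uU.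
(* The value u(a)/u(b) is the same for all fractions a/b representing [x]; recording this for all of
   them lets [w] be computed from any representation. *)
have wex (x : resring) : exists d, forall a b, ~ P b -> x * res_map b = res_map a -> d * u b = u a.
  have [a [b [hb e]]] := res_map_frac x.
  have [v hv] := uU _ hb; exists (u a * v) => a' b' hb' e'.
  have h : P (a' * b - a * b').
    apply/res_map_eq0; rewrite (ring_homB res_map_hom) !(ring_homM res_map_hom) -e -e'.
    by ring.
  have := uP _ h; rewrite (ring_homB hu) !(ring_homM hu) => /eqP; rewrite subr_eq0 => /eqP e2.
  have -> : u a * v * u b' = v * (u a * u b') by ring.
  by rewrite -e2 mulrCA [v * _]mulrC hv mulr1.
pose w x := sval (cid (wex x)).
have wE x a b : ~ P b -> x * res_map b = res_map a -> w x * u b = u a.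
  by rewrite /w; case: cid => d /=; apply.
have wk a : w (res_map a) = u a.
  rewrite -[LHS]mulr1 -(ring_hom1 hu); apply: wE; first by case: Pp.
  by rewrite (ring_hom1 res_map_hom) mulr1.
have hmul b d : ~ P b -> ~ P d -> ~ P (b * d) by move=> hb hd /(prime_cancel hb).
have wh : ring_hom w.
  split; first by rewrite -(ring_hom1 res_map_hom) wk (ring_hom1 hu).
  - move=> x y; have [a [b [hb e]]] := res_map_frac x; have [c [d [hd e']]] := res_map_frac y.
    apply: (unitP_reg (uU _ (hmul _ _ hb hd))).
    rewrite (@wE _ (a * d + c * b)) ?(ring_homM hu) ?(ring_homD hu) ?(ring_homM hu);
      [|exact: hmul|].
    + by rewrite -(wE _ _ _ hb e) -(wE _ _ _ hd e'); ring.
    + by rewrite (ring_homD res_map_hom) !(ring_homM res_map_hom) -e -e'; ring.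
  - move=> x y; have [a [b [hb e]]] := res_map_frac x; have [c [d [hd e']]] := res_map_frac y.
    apply: (unitP_reg (uU _ (hmul _ _ hb hd))).
    rewrite (@wE _ (a * c)) ?(ring_homM hu);
      [|exact: hmul|].
    + by rewrite -(wE _ _ _ hb e) -(wE _ _ _ hd e'); ring.
    + by rewrite !(ring_homM res_map_hom) -e -e'; ring.
exists w; split=> // w' [hw' ew']; apply: funext => x.
have [a [b [hb e]]] := res_map_frac x.
apply: (unitP_reg (uU _ hb)).
by rewrite (wE _ _ _ hb e) -!ew' -(ring_homM hw') e.
Qed.

Lemma residue_field_exists : exists (L : fieldType) (k : A -> L),
  is_residue_field P k /\ forall a, k a = 0 <-> P a.
Proof. by exists resring, res_map; split; [exact: res_map_residue | exact: res_map_eq0]. Qed.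

(** [K] is only known through its universal property; inverses are transported from the model along
    mutually inverse maps. *)
Lemma residue_field_inv (K : comPzRingType) (k : A -> K) : is_residue_field P k ->
  forall x : K, x = 0 \/ unitP x.
Proof.
move=> [hk kP kU kup] x.
have [_ rP rU rup] := res_map_residue.
have [w [[hw wk] _]] := kup _ _ res_map_hom rP rU.
have [v [[hv vk] _]] := rup _ _ hk kP kU.
have vw : (fun x => v (w x)) = id.
  have [z [_ zu]] := kup _ _ hk kP kU.
  have <- : z = id by apply: zu.
  apply/esym/zu; split=> [|a]; first exact: ring_hom_comp hw hv.
  by rewrite wk vk.
have xE : x = v (w x) by rewrite -[LHS]/(id x) -vw.
have [e|/resring_inv_ex [y hy]] := eqVneq (w x) 0.
  by left; rewrite xE e (ring_hom0 hv).
by right; exists (v y); rewrite xE -(ring_homM hv) mulrC hy (ring_hom1 hv).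
Qed.

End ResidueField.
(** * Vanishing of tensors and the equational criterion for flatness *)

Section FormalSum.
Variables (T : eqType) (V : zmodType).

Definition delta (m : T) (y : V) (m' : T) : V := if m == m' then y else 0.
Definition fs (l : seq (T * V)) (m : T) : V := \sum_(z <- l) delta z.1 z.2 m.

Lemma fs_cons z l m : fs (z :: l) m = delta z.1 z.2 m + fs l m.
Proof. by rewrite /fs big_cons. Qed.

Lemma fs_notin l m : m \notin unzip1 l -> fs l m = 0.
Proof.
elim: l => [|z l IH]; first by rewrite /fs big_nil.
by rewrite inE negb_or fs_cons /delta eq_sym => /andP[/negbTE -> /IH ->]; rewrite addr0.
Qed.

(** Terms with the same first entry merge by additivity of [G m]. [S] may exceed the support of [l],
    since [fs l] is 0 there. *)
Lemma fs_regroup (W : zmodType) (G : T -> V -> W) (l : seq (T * V)) (S : seq T) :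
  (forall m, {morph G m : x y / x + y}) -> uniq S -> {subset unzip1 l <= S} ->
  \sum_(z <- l) G z.1 z.2 = \sum_(m <- S) G m (fs l m).
Proof.
move=> GD uS; elim: l => [|z l IH] sub.
  rewrite big_nil big1 // => m _.
  by rewrite /fs big_nil (morph_add0 (GD m)).
rewrite big_cons IH; last by move=> m hm; apply: sub; rewrite inE hm orbT.
under [RHS]eq_bigr => m _ do rewrite fs_cons GD.
rewrite big_split /=; congr (_ + _).
have zS : z.1 \in S by apply: sub; rewrite inE eqxx.
rewrite (bigD1_seq z.1) //= /delta eqxx big1 ?addr0 // => m /negbTE hm.
by rewrite eq_sym hm (morph_add0 (GD m)).
Qed.

End FormalSum.

Definition relspan (A B : comPzRingType) (f : A -> B) (J : finType) (Rel : (J -> A) -> Prop)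
    (s : J -> B) : Prop :=
  exists (K : finType) (sg : K -> B) (c : K -> J -> A),
    (forall j, s j = \sum_k sg k * f (c k j)) /\ forall k, Rel (c k).

(** The classical equational criterion: relations with coefficients in [B] come from relations with
    coefficients in [A]. *)
Definition eqcrit (A B : comPzRingType) (f : A -> B) : Prop :=
  forall (J : finType) (r : J -> A) (s : J -> B), \sum_j f (r j) * s j = 0 ->
  relspan f (fun c => \sum_j r j * c j = 0) s.

(* The equational criterion for [A/I -> B/IB], read in [A] and [B]. *)
Definition eqcrit_mod (A B : comPzRingType) (f : A -> B) (I : A -> Prop) : Prop :=
  forall (J : finType) (r : J -> A) (s : J -> B), ext_ideal f I (\sum_j f (r j) * s j) ->
  relspan f (fun c => I (\sum_j r j * c j)) s.

Section RelSpan.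
Variables (A B : comPzRingType) (f : A -> B) (J : finType) (Rel : (J -> A) -> Prop).

Lemma relspan_ext s s' : s =1 s' -> relspan f Rel s -> relspan f Rel s'.
Proof. by move=> e [K [sg [c [h1 h2]]]]; exists K, sg, c; split=> // j; rewrite -e. Qed.

Lemma relspan0 : relspan f Rel (fun=> 0).
Proof.
by exists 'I_0, (fun=> 0), (fun=> fun=> 0); split=> [j|[]//]; rewrite big_ord0.
Qed.

Lemma relspanD s s' : relspan f Rel s -> relspan f Rel s' -> relspan f Rel (fun j => s j + s' j).
Proof.
move=> [K1 [s1 [c1 [e1 h1]]]] [K2 [s2 [c2 [e2 h2]]]].
exists (K1 + K2)%type, (fun k => match k with inl k => s1 k | inr k => s2 k end),
  (fun k => match k with inl k => c1 k | inr k => c2 k end); split; last by case.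
by move=> j; rewrite big_sumType /= e1 e2.
Qed.

Lemma relspan_sum I (r : seq I) (s : I -> J -> B) : (forall i, relspan f Rel (s i)) ->
  relspan f Rel (fun j => \sum_(i <- r) s i j).
Proof.
move=> hs; elim: r => [|i r IH].
  by apply: relspan_ext relspan0 => j; rewrite big_nil.
by apply: relspan_ext (relspanD (hs i) IH) => j; rewrite big_cons.
Qed.

Lemma relspan_gen (b : B) (c : J -> A) : Rel c -> relspan f Rel (fun j => b * f (c j)).
Proof.
by move=> h; exists 'I_1, (fun=> b), (fun=> c); split=> // j; rewrite big_ord1.
Qed.

End RelSpan.

Section Vanishing.
Variables (A B : comPzRingType) (f : A -> B) (M : lmodType A).
Hypothesis hf : ring_hom f.

(* A formal sum of pure tensors is read as a function [M -> B]; the functions below are the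
   [B]-combinations of [A]-relations in [M], and they are exactly the sums vanishing in
   the tensor product. *)
Definition trivial_fun (phi : M -> B) : Prop :=
  exists (K : finType) (sg : K -> B) (c : K -> seq (M * A)),
    (forall k, \sum_(z <- c k) z.2 *: z.1 = 0) /\
    forall m, phi m = \sum_k sg k * f (fs (c k) m).

Lemma trivial_fun_ext phi psi : phi =1 psi -> trivial_fun phi -> trivial_fun psi.
Proof. by move=> e [K [sg [c [h1 h2]]]]; exists K, sg, c; split=> // m; rewrite -e. Qed.

Lemma trivial_fun0 : trivial_fun (fun=> 0).
Proof.
exists 'I_0, (fun=> 0), (fun=> [::]); split=> [k|m]; first by rewrite big_nil.
by rewrite big_ord0.
Qed.

Lemma trivial_funD phi psi : trivial_fun phi -> trivial_fun psi ->
  trivial_fun (fun m => phi m + psi m).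
Proof.
move=> [K1 [s1 [c1 [h1 e1]]]] [K2 [s2 [c2 [h2 e2]]]].
exists (K1 + K2)%type, (fun k => match k with inl k => s1 k | inr k => s2 k end),
  (fun k => match k with inl k => c1 k | inr k => c2 k end); split; first by case.
by move=> m; rewrite big_sumType /= e1 e2.
Qed.

Lemma trivial_funN phi : trivial_fun phi -> trivial_fun (fun m => - phi m).
Proof.
move=> [K [sg [c [h1 h2]]]]; exists K, (fun k => - sg k), c; split=> // m.
by rewrite h2 -sumrN; apply: eq_bigr => k _; rewrite mulNr.
Qed.

Lemma trivial_fun1 (c : seq (M * A)) y : \sum_(z <- c) z.2 *: z.1 = 0 ->
  trivial_fun (fun m => y * f (fs c m)).
Proof.
move=> h; exists 'I_1, (fun=> y), (fun=> c); split=> // m.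
by rewrite big_ord1.
Qed.

(** All functions [M -> B] modulo the trivial ones: a target made for testing a formal sum, in which
    vanishing means exactly that its coefficient function is trivial. *)
Definition van_zraw : zraw.
Proof.
refine (@ZRaw (M -> B) (fun phi psi => trivial_fun (fun m => phi m - psi m)) (fun=> 0)
  (fun phi psi m => phi m + psi m) (fun phi m => - phi m) _ _ _ _ _ _ _ _ _).
- by move=> x; apply: trivial_fun_ext trivial_fun0 => m; rewrite subrr.
- by move=> x y h; apply: trivial_fun_ext (trivial_funN h) => m; ring.
- by move=> x y z h h'; apply: trivial_fun_ext (trivial_funD h h') => m; ring.
- by move=> x x' y y' h h'; apply: trivial_fun_ext (trivial_funD h h') => m; ring.
- by move=> x y h; apply: trivial_fun_ext (trivial_funN h) => m; ring.
- by move=> x y z; apply: trivial_fun_ext trivial_fun0 => m; ring.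
- by move=> x y; apply: trivial_fun_ext trivial_fun0 => m; ring.
- by move=> x; apply: trivial_fun_ext trivial_fun0 => m; ring.
- by move=> x; apply: trivial_fun_ext trivial_fun0 => m; ring.
Defined.

Lemma delta_hom (m m' : M) (a : A) : f (delta m a m') = delta m (f a) m'.
Proof. by rewrite /delta; case: ifP => // _; rewrite (ring_hom0 hf). Qed.

Lemma delta_mul (m m' : M) (y b : B) : y * delta m b m' = delta m (y * b) m'.
Proof. by rewrite /delta; case: ifP => // _; rewrite mulr0. Qed.

Lemma deltaB (m m' : M) (y b : B) : delta m (y + b) m' = delta m y m' + delta m b m'.
Proof. by rewrite /delta; case: ifP => // _; rewrite addr0. Qed.

Lemma deltaN (m m' : M) (y : B) : delta m (- y) m' = - delta m y m'.
Proof. by rewrite /delta; case: ifP => // _; rewrite oppr0. Qed.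

Lemma van_balanced : balanced f (fun m y => zpi van_zraw (delta m y)).
Proof.
split.
- move=> m m' y; rewrite -[RHS]zpiD; apply/zpiP => /=.
  (* Bilinearity in [M] amounts to two trivial relations: 1(m + m') - 1m - 1m' = 0 here, and 1(am) -
     am = 0 for scalars below. *)
  have h : \sum_(z <- [:: (m + m', 1); (m, -1); (m', -1)] : seq (M * A)) z.2 *: z.1 = 0.
    by rewrite !big_cons big_nil /= !scaleN1r scale1r addr0 -opprD subrr.
  apply: trivial_fun_ext (trivial_fun1 y h) => u.
  rewrite /fs !big_cons big_nil /= !(ring_homD hf) !delta_hom (ring_homN hf) (ring_hom1 hf).
  by rewrite (ring_hom0 hf) !mulrDr !delta_mul !mulrN mulr1 !deltaN mulr0; ring.
- move=> m y y'; rewrite -[RHS]zpiD; apply/zpiP => /=.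
  by apply: trivial_fun_ext trivial_fun0 => u; rewrite deltaB; ring.
- move=> a m y; apply/zpiP => /=.
  have h : \sum_(z <- [:: (a *: m, 1); (m, - a)] : seq (M * A)) z.2 *: z.1 = 0.
    by rewrite !big_cons big_nil /= scale1r scaleNr addr0 subrr.
  apply: trivial_fun_ext (trivial_fun1 y h) => u.
  rewrite /fs !big_cons big_nil /= !(ring_homD hf) !delta_hom (ring_homN hf) (ring_hom1 hf).
  by rewrite (ring_hom0 hf) !mulrDr !delta_mul !mulrN mulr1 !deltaN mulr0 (mulrC y); ring.
Qed.

Lemma vanishing (l : seq (M * B)) :
  (forall (N : zmodType) (g : M -> B -> N), balanced f g -> bsum g l = 0) ->
  trivial_fun (fs l).
Proof.
move=> /(_ _ _ van_balanced) h.
have e : zpi van_zraw (fs l) = 0.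
  rewrite -h; elim: l {h} => [|z l IH].
    rewrite /bsum big_nil; apply/zpi_eq0 => /=.
    by apply: trivial_fun_ext trivial_fun0 => m; rewrite /fs big_nil; ring.
  rewrite /bsum big_cons -[X in _ = _ + X]IH -[RHS]zpiD; apply/zpiP => /=.
  by apply: trivial_fun_ext trivial_fun0 => m; rewrite fs_cons subrr.
by move/zpi_eq0: e; apply: trivial_fun_ext => m /=; rewrite subr0.
Qed.

Hypothesis fE : eqcrit f.

(** The criterion for several equations at once: each new column is treated by applying [fE] to the
    coefficients [ta] already found, and multiplying by the resulting matrix preserves the equations
    solved before. *)
Lemma eqcrit_matrix (K : finType) (sg : K -> B) (T : eqType) (D : seq T) (c : K -> T -> A) :
  (forall m, m \in D -> \sum_k sg k * f (c k m) = 0) ->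
  exists (J : finType) (ta : J -> B) (d : J -> K -> A),
    (forall k, sg k = \sum_j ta j * f (d j k)) /\
    forall m, m \in D -> forall j, \sum_k d j k * c k m = 0.
Proof.
elim: D => [|m D IH] hD.
  exists K, sg, (fun j k => (j == k)%:R); split=> // k.
  rewrite (bigD1 k) //= eqxx (ring_hom1 hf) mulr1 big1 ?addr0 // => j /negbTE ->.
  by rewrite (ring_hom0 hf) mulr0.
have [|J [ta [d [h1 h2]]]] := IH; first by move=> m' hm'; apply: hD; rewrite inE hm' orbT.
have : \sum_j f (\sum_k d j k * c k m) * ta j = 0.
  rewrite -[RHS](hD m) ?inE ?eqxx //.
  under [RHS]eq_bigr => k _ do rewrite h1 mulr_suml.
  rewrite [RHS]exchange_big; apply: eq_bigr => j _.
  rewrite (ring_hom_sum hf) mulr_suml; apply: eq_bigr => k _.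
  by rewrite (ring_homM hf); ring.
move=> /fE [L [rho [e [h3 h4]]]].
exists L, rho, (fun l k => \sum_j e l j * d j k); split.
  move=> k; rewrite h1.
  under eq_bigr => j _ do rewrite h3 mulr_suml.
  rewrite exchange_big; apply: eq_bigr => l _.
  rewrite (ring_hom_sum hf) mulr_sumr; apply: eq_bigr => j _.
  by rewrite (ring_homM hf); ring.
have E m' l : \sum_k (\sum_j e l j * d j k) * c k m' = \sum_j (\sum_k d j k * c k m') * e l j.
  under eq_bigr => k _ do rewrite mulr_suml.
  rewrite exchange_big; apply: eq_bigr => j _.
  by rewrite mulr_suml; apply: eq_bigr => k _; ring.
move=> m'; rewrite inE => /orP[/eqP ->|hm'] l; rewrite E; first exact: h4.
by apply: big1 => j _; rewrite h2 ?mul0r.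
Qed.

(** The relations given by [vanishing] may involve elements of [M] that do not occur in [l]. Their
    total coefficient is 0 in [B], so [eqcrit_matrix] recombines the relations until these
    coefficients are 0 already in [A]. *)
Lemma vanishing_eqcrit (l : seq (M * B)) :
  (forall (N : zmodType) (g : M -> B -> N), balanced f g -> bsum g l = 0) ->
  exists (K : finType) (sg : K -> B) (c : K -> M -> A),
    (forall m, fs l m = \sum_k sg k * f (c k m)) /\
    forall k, \sum_(m <- undup (unzip1 l)) c k m *: m = 0.
Proof.
move=> /vanishing [K [sg [c [h1 h2]]]].
pose S := undup (flatten [seq unzip1 (c k) | k <- enum K] ++ unzip1 l).
have [m|J [ta [d [h3 h4]]]] :=
    @eqcrit_matrix K sg _ [seq m <- S | m \notin unzip1 l] (fun k m => fs (c k) m).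
  by rewrite mem_filter => /andP[hm _]; rewrite -h2 fs_notin.
exists J, ta, (fun j m => \sum_k d j k * fs (c k) m); split.
  move=> m; rewrite h2; under eq_bigr => k _ do rewrite h3 mulr_suml.
  rewrite exchange_big; apply: eq_bigr => j _.
  rewrite (ring_hom_sum hf) mulr_sumr; apply: eq_bigr => k _.
  by rewrite (ring_homM hf) mulrA.
move=> j.
have SE : \sum_(m <- S) (\sum_k d j k * fs (c k) m) *: m = 0.
  under eq_bigr => m _ do rewrite scaler_suml.
  rewrite exchange_big big1 //= => k _.
  transitivity (d j k *: \sum_(z <- c k) z.2 *: z.1); last by rewrite h1 scaler0.
  rewrite (@fs_regroup _ _ _ (fun m a => a *: m) (c k) S).
  - by rewrite scaler_sumr; apply: eq_bigr => m _; rewrite scalerA.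
  - by move=> m x y; rewrite scalerDl.
  - exact: undup_uniq.
  - move=> m hm; rewrite mem_undup mem_cat; apply/orP; left.
    by apply/flatten_mapP; exists k; rewrite ?mem_enum.
move: SE; rewrite (bigID (fun m => m \in unzip1 l)) /= [X in _ + X]big1_seq ?addr0; last first.
  by move=> m /andP[hm hS]; rewrite h4 ?scale0r // mem_filter hm.
rewrite -big_filter => SE; apply: etrans SE; apply: perm_big; apply: uniq_perm.
- exact: undup_uniq.
- by rewrite filter_uniq // undup_uniq.
- by move=> m; rewrite mem_filter !mem_undup mem_cat; case: (m \in unzip1 l); rewrite ?orbT.
Qed.

End Vanishing.

(** A sum vanishing in the tensor product with [M'] does so by relations among the elements [phi m]
    that occur in it. No element outside the image of [phi] intervenes, so injectivity pulls the
    relations back to [M]. *)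
Lemma eqcrit_flat (A B : comPzRingType) (f : A -> B) : ring_hom f -> eqcrit f -> flat f.
Proof.
move=> hf fE M M' phi phil phi_inj T t T' t' psi ht ht' psiD psiE x y exy.
have phiD : {morph phi : x y / x + y} by move=> a b; have := phil 1 a b; rewrite !scale1r.
have phi0 := morph_add0 phiD.
have phiZ a m : phi (a *: m) = a *: phi m by have := phil a m 0; rewrite phi0 !addr0.
apply: subr0_eq.
have : psi (x - y) = 0 by rewrite psiD (morph_addN psiD) exy subrr.
have [l ->] := tensor_mod_span ht (x - y).
rewrite /bsum (morph_add_sum psiD); under eq_bigr => z _ do rewrite psiE.
move=> e; pose l' := [seq (phi z.1, z.2) | z <- l].
have /(tensor_mod_eq0 ht') /(vanishing_eqcrit hf fE) [K [sg [c [h1 h2]]]] : bsum t' l' = 0.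
  by rewrite /bsum big_map.
have [[tD tD' tA] _] := ht.
rewrite (@fs_regroup _ _ _ t l (undup (unzip1 l))) ?undup_uniq //; last first.
  by move=> m; rewrite mem_undup.
have fsE m : fs l m = \sum_k sg k * f (c k (phi m)).
  rewrite -h1 /fs big_map; apply: eq_bigr => z _ /=.
  by rewrite /delta (inj_eq phi_inj).
have tsum m I (r : seq I) F : t m (\sum_(i <- r) F i) = \sum_(i <- r) t m (F i).
  by apply: (@morph_add_sum _ _ (t m)) => ? ?; apply: tD'.
have tsuml b I (r : seq I) F : t (\sum_(i <- r) F i) b = \sum_(i <- r) t (F i) b.
  by apply: (@morph_add_sum _ _ (t^~ b)) => ? ?; apply: tD.
under eq_bigr => m _ do rewrite fsE tsum.
rewrite exchange_big big1 //= => k _.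
under eq_bigr => m _ do rewrite mulrC -tA.
rewrite -tsuml.
suff -> : \sum_(m <- undup (unzip1 l)) c k (phi m) *: m = 0.
  by apply: (@morph_add0 _ _ (t^~ (sg k))) => ? ?; apply: tD.
apply: (phi_inj); rewrite phi0; apply: etrans (h2 k); rewrite (morph_add_sum phiD).
have -> : unzip1 l' = [seq phi m | m <- unzip1 l] by rewrite /unzip1 -!map_comp.
rewrite (undup_map_inj phi_inj) big_map; apply: eq_bigr => m _; exact: phiZ.
Qed.
(** * The stable prime extension property implies the equational criterion *)

(** Dual numbers, (a, b) standing for a + b eps with eps^2 = 0; the separate name avoids the
    componentwise product. A ring map into them carries a constant and a linear coefficient
    together, so identities of linear coefficients follow from [polyring_ext]. *)
Definition dual (A : comPzRingType) := (A * A)%type.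
HB.instance Definition _ (A : comPzRingType) := GRing.Zmodule.copy (dual A) (A * A)%type.

Section Dual.
Variable A : comPzRingType.
Implicit Types x y z : dual A.
Definition dmul x y : dual A := (x.1 * y.1, x.1 * y.2 + x.2 * y.1).
Fact dmulA : associative dmul.
Proof. by move=> x y z; rewrite /dmul /=; congr pair; ring. Qed.
Fact dmulC : commutative dmul.
Proof. by move=> x y; rewrite /dmul /=; congr pair; ring. Qed.
Fact dmul1 : left_id (1, 0) dmul.
Proof. by move=> [a b]; rewrite /dmul /=; congr pair; ring. Qed.
Fact dmulD : left_distributive dmul +%R.
Proof. by move=> x y z; rewrite /dmul /=; congr pair; rewrite /=; ring. Qed.
HB.instance Definition _ := GRing.Zmodule_isComPzRing.Build (dual A) dmulA dmulC dmul1 dmulD.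

Lemma dualP x y : x.1 = y.1 -> x.2 = y.2 -> x = y.
Proof. by case: x y => [a b] [c d] /= -> ->. Qed.

Lemma dual_fst_hom : ring_hom (fun x : dual A => x.1). Proof. by []. Qed.

Lemma dual_const_hom : ring_hom (fun a : A => (a, 0) : dual A).
Proof.
split=> // x y; apply: dualP => //=; first by rewrite addr0.
by rewrite mulr0 mul0r addr0.
Qed.

End Dual.

Section LinearPart.
Variables (n : nat) (A P : comPzRingType) (c : A -> P) (X : 'I_n -> P).
Hypothesis hP : is_polyring c X.

(* [ev0 p] is the constant coefficient of [p] and [lam i p] its coefficient at [X i]; together
   they are the truncation of [p] to dual numbers in the direction [X i]. *)
Definition is_linpart (ev0 : P -> A) (lam : 'I_n -> P -> A) : Prop :=
  [/\ ring_hom ev0 /\ forall i, ring_hom (fun p => (ev0 p, lam i p) : dual A),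
      forall a, ev0 (c a) = a, forall i a, lam i (c a) = 0,
      forall i, ev0 (X i) = 0 & forall i j, lam i (X j) = (i == j)%:R].

Lemma linpart_exists : exists ev0 lam, is_linpart ev0 lam.
Proof.
have hd := @dual_const_hom A.
have [e0 [he0 e0c e0X]] := polyring_map hP (fun=> 0) (@ring_hom_id A).
pose D i := cid (polyring_map hP (fun j => (0, (i == j)%:R) : dual A) hd).
exists e0, (fun i p => (sval (D i) p).2).
have DE i p : (sval (D i) p).1 = e0 p.
  case: (D i) => w [hw wc wX] /=.
  apply: (polyring_ext hP (w := fun x => (w x).1)) => //.
  - exact: ring_hom_comp hw (@dual_fst_hom A).
  - by move=> a; rewrite wc e0c.
  - by move=> j; rewrite wX e0X.
split=> //.
- split=> // i; have -> : (fun p => (e0 p, (sval (D i) p).2) : dual A) = sval (D i).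
    by apply: funext => p; apply: dualP => /=.
  by case: (D i) => w [].
- by move=> i a; case: (D i) => w [hw wc wX] /=; rewrite wc.
- by move=> i j; case: (D i) => w [hw wc wX] /=; rewrite wX.
Qed.

Variables (ev0 : P -> A) (lam : 'I_n -> P -> A).
Hypothesis hl : is_linpart ev0 lam.

Lemma linpart_const a : ev0 (c a) = a. Proof. by case: hl. Qed.
Lemma linpart_lin_const i a : lam i (c a) = 0. Proof. by case: hl. Qed.
Lemma linpart_var i : ev0 (X i) = 0. Proof. by case: hl. Qed.
Lemma linpart_lin_var i j : lam i (X j) = (i == j)%:R. Proof. by case: hl. Qed.
Lemma linpart_linD i p q : lam i (p + q) = lam i p + lam i q.
Proof. by case: hl => -[_ /(_ i) h] _ _ _ _; case: (ring_homD h p q). Qed.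
Lemma linpart_linM i p q : lam i (p * q) = ev0 p * lam i q + lam i p * ev0 q.
Proof. by case: hl => -[_ /(_ i) h] _ _ _ _; case: (ring_homM h p q). Qed.

Lemma linpart_hom : ring_hom ev0. Proof. by case: hl => -[]. Qed.
Lemma linpart_dual_hom i : ring_hom (fun p => (ev0 p, lam i p) : dual A).
Proof. by case: hl => -[]. Qed.
Lemma linpart_lin_sum i I (r : seq I) F : lam i (\sum_(j <- r) F j) = \sum_(j <- r) lam i (F j).
Proof. by apply: (@morph_add_sum _ _ (lam i)) => p q; apply: linpart_linD. Qed.

End LinearPart.

Lemma polyC_hom (D : comNzRingType) : ring_hom (fun a : D => a%:P).
Proof. by split=> [|x y|x y]; rewrite ?polyCD ?polyCM. Qed.

(** * Ideals of curves over the residue field *)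

Section StableEq.
Variables (A B : comPzRingType) (f : A -> B) (P : A -> Prop).
Hypotheses (hf : ring_hom f) (fS : stable_PEP f) (Pp : prime_ideal P).
Variables (L : fieldType) (k : A -> L).
Hypotheses (hk : ring_hom k) (kP : forall a, k a = 0 <-> P a).

Section Curve.
Variables (n : nat) (PA PB : comPzRingType) (cA : A -> PA) (XA : 'I_n -> PA)
  (cB : B -> PB) (XB : 'I_n -> PB) (F : PA -> PB).
Hypotheses (hPA : is_polyring cA XA) (hPB : is_polyring cB XB) (hF : ring_hom F)
  (Fc : forall a, F (cA a) = cB (f a)) (FX : forall i, F (XA i) = XB i).
Variables (ev : PA -> {poly L}) (v : 'I_n -> {poly L}).
Hypotheses (hev : ring_hom ev) (evc : forall a, ev (cA a) = (k a)%:P)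
  (evX : forall i, ev (XA i) = v i) (v0 : forall i, (v i)`_0 = 0).

(** The ideal of the curve t -> v(t) over [L]. By [v0] the curve passes through the origin, so
    elements of [Q] have constant coefficient in [P]. *)
Let Q (q : PA) := ev q = 0.

Lemma curve_prime : prime_ideal Q.
Proof.
apply: prime_ker => //; split; first by apply/eqP; apply: oner_neq0.
by move=> x y /eqP; rewrite mulf_eq0 => /orP[] /eqP; auto.
Qed.

(** Both alternatives of the prime extension property suffice, since the unit ideal contains every
    factor. *)
Lemma curve_ext_prime x y : ext_ideal F Q (x * y) -> ext_ideal F Q x \/ ext_ideal F Q y.
Proof.
case: (fS hPA hPB hF Fc FX curve_prime) => [[_ _]|h1 _]; first exact.
by left; apply: ideal1_all h1; apply: ext_ideal_is_ideal.
Qed.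

Variables (ev0 : PA -> A) (lam : 'I_n -> PA -> A) (ev0' : PB -> B) (lam' : 'I_n -> PB -> B).
Hypotheses (hl : is_linpart cA XA ev0 lam) (hl' : is_linpart cB XB ev0' lam').

(** The chain rule at t = 0. Both sides are ring maps to dual numbers over [L], so constants and
    variables suffice. *)
Lemma curve_coef q : (ev q)`_0 = k (ev0 q) /\ (ev q)`_1 = \sum_i k (lam i q) * (v i)`_1.
Proof.
have h1 : ring_hom (fun q => ((ev q)`_0, (ev q)`_1) : dual L).
  split.
  - by rewrite (ring_hom1 hev) !coef1.
  - by move=> x y; rewrite (ring_homD hev) !coefD.
  - move=> x y; apply: dualP; rewrite (ring_homM hev) /= ?coef0M //.
    by rewrite coefM !big_ord_recl big_ord0 /= addr0.
have h2 : ring_hom (fun q => (k (ev0 q), \sum_i k (lam i q) * (v i)`_1) : dual L).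
  split.
  - apply: dualP => /=; first by rewrite (ring_hom1 (linpart_hom hl)) (ring_hom1 hk).
    rewrite big1 // => i _.
    by rewrite -(ring_hom1 (polyring_hom hPA)) (linpart_lin_const hl) (ring_hom0 hk) mul0r.
  - move=> x y; apply: dualP => /=.
      by rewrite (ring_homD (linpart_hom hl)) (ring_homD hk).
    by rewrite -big_split; apply: eq_bigr => i _; rewrite (linpart_linD hl) (ring_homD hk) mulrDl.
  - move=> x y; apply: dualP => /=.
      by rewrite (ring_homM (linpart_hom hl)) (ring_homM hk).
    rewrite mulr_sumr mulr_suml -big_split; apply: eq_bigr => i _ /=.
    by rewrite (linpart_linM hl) (ring_homD hk) !(ring_homM hk); ring.
suff e : ((ev q)`_0, (ev q)`_1) = (k (ev0 q), \sum_i k (lam i q) * (v i)`_1) :> dual L.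
  by case: e.
apply: (polyring_ext hPA h1 h2).
- move=> a; rewrite evc (linpart_const hl) !coefC /=; congr pair.
  by rewrite big1 // => i _; rewrite (linpart_lin_const hl) (ring_hom0 hk) mul0r.
- move=> j; rewrite evX v0 (linpart_var hl) (ring_hom0 hk); congr pair.
  rewrite (bigD1 j) //= (linpart_lin_var hl) eqxx (ring_hom1 hk) mul1r big1 ?addr0 //.
  by move=> i /negbTE ij; rewrite (linpart_lin_var hl) ij (ring_hom0 hk) mul0r.
Qed.

Lemma ev0_F q : ev0' (F q) = f (ev0 q).
Proof.
apply: (polyring_ext hPA (w := fun q => ev0' (F q)) (w' := fun q => f (ev0 q))).
- exact: ring_hom_comp hF (linpart_hom hl').
- exact: ring_hom_comp (linpart_hom hl) hf.
- by move=> a; rewrite Fc (linpart_const hl') (linpart_const hl).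
- by move=> i; rewrite FX (linpart_var hl') (linpart_var hl) (ring_hom0 hf).
Qed.

Lemma lam_F i q : lam' i (F q) = f (lam i q).
Proof.
have hd : ring_hom (fun x : dual A => (f x.1, f x.2) : dual B).
  split=> [|x y|x y]; apply: dualP => /=.
  - exact: ring_hom1.
  - exact: ring_hom0.
  - exact: ring_homD.
  - exact: ring_homD.
  - exact: ring_homM.
  - by rewrite (ring_homD hf) !(ring_homM hf).
suff e : (ev0' (F q), lam' i (F q)) = (f (ev0 q), f (lam i q)) :> dual B by case: e.
apply: (polyring_ext hPA (ring_hom_comp hF (linpart_dual_hom hl' i))
  (ring_hom_comp (linpart_dual_hom hl i) hd)).
- move=> a; rewrite Fc (linpart_const hl') (linpart_const hl) (linpart_lin_const hl').
  by rewrite (linpart_lin_const hl) (ring_hom0 hf).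
- move=> j; rewrite FX (linpart_var hl') (linpart_var hl) (linpart_lin_var hl').
  by rewrite (linpart_lin_var hl) (ring_hom0 hf); case: eqP => _;
    rewrite ?(ring_hom1 hf) ?(ring_hom0 hf).
Qed.

Lemma curve_ext_const x : ext_ideal F Q x -> ext_ideal f P (ev0' x).
Proof.
move: x; apply: ext_min; first exact: ideal_preim (linpart_hom hl') (ext_ideal_is_ideal f P).
move=> q Qq; rewrite ev0_F; apply: ext_gen; apply/kP.
  by have [<- _] := curve_coef q; rewrite Qq coef0.
Qed.

Lemma curve_ext_lin x : ext_ideal F Q x ->
  relspan f (fun c => \sum_i k (c i) * (v i)`_1 = 0) (fun i => lam' i x).
Proof.
case/extP=> J [b [q [Qq ->]]].
apply: (relspan_ext (s := fun i => \sum_j lam' i (b j * F (q j)))).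
  by move=> i; rewrite (linpart_lin_sum hl').
apply: relspan_sum => j.
have [e0 e1] := curve_coef (q j).
(* Leibniz rule. The vector of the [lam i (q j)] is a relation because the coefficient of t in
   [ev (q j)] is 0; the remaining vectors have the single entry [ev0 (q j)], which [k] kills. *)
apply: (relspan_ext (s := fun i => ev0' (b j) * f (lam i (q j)) +
    \sum_i0 lam' i0 (b j) * f (if i == i0 then ev0 (q j) else 0))).
  move=> i; rewrite (linpart_linM hl') ev0_F lam_F; congr (_ + _).
  rewrite (bigD1 i) //= eqxx big1 ?addr0 // => i0 ne.
  by rewrite eq_sym (negbTE ne) (ring_hom0 hf) mulr0.
apply: relspanD.
  by apply: relspan_gen; rewrite -e1 Qq coef0.
apply: relspan_sum => i0; apply: relspan_gen.
apply: big1 => i _; case: ifP => _; last by rewrite (ring_hom0 hk) mul0r.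
by rewrite -e0 Qq coef0 mul0r.
Qed.

End Curve.

Lemma poly_map_exists n : exists (PA PB : comPzRingType) (cA : A -> PA) (XA : 'I_n -> PA)
  (cB : B -> PB) (XB : 'I_n -> PB) (F : PA -> PB),
  [/\ is_polyring cA XA, is_polyring cB XB, ring_hom F, forall a, F (cA a) = cB (f a) &
     forall i, F (XA i) = XB i].
Proof.
have [PA [cA [XA hPA]]] := polyring_exists n A.
have [PB [cB [XB hPB]]] := polyring_exists n B.
have [F [hF Fc FX]] := polyring_map hPA XB (ring_hom_comp hf (polyring_hom hPB)).
by exists PA, PB, cA, XA, cB, XB, F.
Qed.

(* For [r] not in [P] the curve [(r t, r t^2)] has prime ideal [Q] containing [X^2 - r Y], so
   [r = 0] in [B/PB] would put [X] into [Q B[X,Y]]; but the coefficient of [X] in an element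
   of [Q] lies in [P]. *)
Lemma stable_PEP_ext_contract r : ~ P r -> ext_ideal f P (f r) -> ext_ideal f P 1.
Proof.
move=> hr hfr.
have [PA [PB [cA [XA [cB [XB [F [hPA hPB hF Fc FX]]]]]]]] := poly_map_exists 2.
pose v (i : 'I_2) : {poly L} := (k r)%:P * 'X^(i.+1).
have [ev [hev evc evX]] := polyring_map hPA v (ring_hom_comp hk (polyC_hom L)).
have v0 i : (v i)`_0 = 0 by rewrite /v coefCM coefXn mulr0.
have [ev0 [lam hl]] := linpart_exists hPA; have [ev0' [lam' hl']] := linpart_exists hPB.
pose i0 : 'I_2 := ord0; pose i1 : 'I_2 := ord_max.
pose Q q := ev q = 0.
have Qi := ext_ideal_is_ideal F Q; have [_ QD QM] := Qi.
have XQ : ext_ideal F Q (XB i0).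
  (* X^2 = (X^2 - rY) + Yr with [f r] in PB; primality then extracts X from its square. *)
  suff : ext_ideal F Q (XB i0 * XB i0).
    by move/(curve_ext_prime hPA hPB hF Fc FX hev) => [].
  have -> : XB i0 * XB i0 = F (XA i0 * XA i0 - cA r * XA i1) + XB i1 * cB (f r).
    by rewrite (ring_homB hF) !(ring_homM hF) Fc !FX; ring.
  apply: (QD).
    apply: ext_gen; rewrite /Q (ring_homB hev) !(ring_homM hev) evc !evX /v /=.
    by ring.
  apply: (QM); move: (f r) hfr; apply: ext_min.
    exact: ideal_preim (polyring_hom hPB) Qi.
  by move=> a Pa; rewrite -Fc; apply: ext_gen; rewrite /Q evc (proj2 (kP a)).
have [K [sg [c [e h]]]] := curve_ext_lin hPA hF Fc FX hev evc evX v0 hl hl' XQ.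
have <- : lam' i0 (XB i0) = 1 by rewrite (linpart_lin_var hl') eqxx.
rewrite e.
have [_ PD PM] := ext_ideal_is_ideal f P.
apply: ideal_sum => [|j _]; first exact: ext_ideal_is_ideal.
apply: PM; apply: ext_gen; apply/kP.
(* Since r t^2 has no linear term, the relation reduces to k(c_0) k(r) = 0, and k(r) is nonzero. *)
have := h j; rewrite !big_ord_recl big_ord0 /v !coefCM !coefXn /= mulr1 !mulr0 !addr0.
move=> /eqP; rewrite mulf_eq0 => /orP[] /eqP //.
by move=> /kP.
Qed.

(** A vector with one entry in [P] and zeros elsewhere is a relation modulo [P] for any [r], and
    such vectors span everything with entries in PB. *)
Lemma ext_relspan (J : finType) (r : J -> A) (s : J -> B) :
  (forall j, ext_ideal f P (s j)) -> relspan f (fun c => P (\sum_j r j * c j)) s.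
Proof.
move=> hs; have [[P0 PD PM] _ _] := Pp.
pose e j0 j : B := if j0 == j then s j else 0.
apply: (relspan_ext (s := fun j => \sum_j0 e j0 j)).
  by move=> j; rewrite (bigD1 j) //= /e eqxx big1 ?addr0 // => j0 /negbTE ->.
apply: relspan_sum => j0.
have /extP [K [b [a [aP sE]]]] := hs j0.
apply: (relspan_ext (s := fun j => \sum_k b k * f (if j0 == j then a k else 0))).
  move=> j; rewrite /e; case: eqP => [<-|_]; first by rewrite sE.
  by rewrite big1 // => k0 _; rewrite (ring_hom0 hf) mulr0.
apply: relspan_sum => k0; apply: relspan_gen; apply: ideal_sum => [|j _]; first by case: Pp.
by apply: PM; case: ifP.
Qed.

(* The kernel [Q] of [A[X] -> kappa_P[t]], [X_i |-> r_i t], contains [r_j X_i - r_i X_j], so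
   [r_j (sum_i s_i X_i)] lies in [Q B[X]]; the linear parts of elements of [Q] are the
   relations on [r] modulo [P]. *)
Lemma stable_PEP_eqcrit_ord (n : nat) (r : 'I_n -> A) (s : 'I_n -> B) :
  ext_ideal f P (\sum_j f (r j) * s j) -> relspan f (fun c => P (\sum_j r j * c j)) s.
Proof.
move=> hrs; have [[P0 PD PM] _ _] := Pp.
have [PA [PB [cA [XA [cB [XB [F [hPA hPB hF Fc FX]]]]]]]] := poly_map_exists n.
pose v (i : 'I_n) : {poly L} := (k (r i))%:P * 'X.
have [ev [hev evc evX]] := polyring_map hPA v (ring_hom_comp hk (polyC_hom L)).
have v0 i : (v i)`_0 = 0 by rewrite /v coefCM coefX mulr0.
have [ev0 [lam hl]] := linpart_exists hPA; have [ev0' [lam' hl']] := linpart_exists hPB.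
pose Q q := ev q = 0.
have Qi := ext_ideal_is_ideal F Q; have [_ QD QM] := Qi.
have cQ y : ext_ideal f P y -> ext_ideal F Q (cB y).
  move: y; apply: ext_min.
    exact: ideal_preim (polyring_hom hPB) Qi.
  by move=> a Pa; rewrite -Fc; apply: ext_gen; rewrite /Q evc (proj2 (kP a)).
pose x := \sum_i cB (s i) * XB i.
have rx j : ext_ideal F Q (F (cA (r j)) * x).
  have -> : F (cA (r j)) * x =
      \sum_i cB (s i) * F (cA (r j) * XA i - cA (r i) * XA j) + XB j * cB (\sum_i f (r i) * s i).
    rewrite (ring_hom_sum (polyring_hom hPB)) !mulr_sumr -big_split.
    apply: eq_bigr => i _ /=.
    by rewrite (ring_homB hF) !(ring_homM hF) !Fc !FX (ring_homM (polyring_hom hPB)); ring.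
  apply: (QD); last by apply: (QM); apply: cQ.
  apply: ideal_sum => // i _; apply: (QM); apply: ext_gen.
  by rewrite /Q (ring_homB hev) !(ring_homM hev) !evc !evX /v; ring.
(* If x lies in Q B[X], its linear coefficients are the [s i], and [curve_ext_lin] applies. *)
have [xQ|xQ] := pselect (ext_ideal F Q x).
  have [K [sg [c [e h]]]] := curve_ext_lin hPA hF Fc FX hev evc evX v0 hl hl' xQ.
  exists K, sg, c; split=> [i|j].
    rewrite -e /x (linpart_lin_sum hl') (bigD1 i) //= big1 ?addr0 => [|j ne].
      by rewrite (linpart_linM hl') (linpart_lin_var hl') (linpart_const hl')
        (linpart_var hl') eqxx mulr1 mulr0 addr0.
    by rewrite (linpart_linM hl') (linpart_lin_var hl') (linpart_var hl') eq_sym (negbTE ne)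
      !mulr0 addr0.
  apply/kP; rewrite -[RHS](h j) (ring_hom_sum hk); apply: eq_bigr => i _.
  by rewrite /v coefCM coefX mulr1 (ring_homM hk) mulrC.
(* Otherwise primality puts the constant [r j] into Q B[X], and its constant coefficient into PB. *)
have rP j : ext_ideal f P (f (r j)).
  have [|//] := curve_ext_prime hPA hPB hF Fc FX hev (rx j).
  move=> /(curve_ext_const hPA hF Fc FX hev evc evX v0 hl hl').
  by rewrite Fc (linpart_const hl').
(* If some [r j] is outside [P], then PB = B and [ext_relspan] applies; if all are in [P], every
   vector is a relation. *)
have [rP'|/existsNP [j hj]] := pselect (forall j, P (r j)); last first.
  apply: ext_relspan => i; apply: ideal1_all; first exact: ext_ideal_is_ideal.
  exact: stable_PEP_ext_contract hj (rP j).
apply: (relspan_ext (s := fun i => \sum_j s j * f (j == i)%:R)).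
  move=> i; rewrite (bigD1 i) //= eqxx (ring_hom1 hf) mulr1 big1 ?addr0 // => j /negbTE ->.
  by rewrite (ring_hom0 hf) mulr0.
apply: relspan_sum => j; apply: relspan_gen; apply: ideal_sum => [|i _]; first by case: Pp.
by apply: ideal_mulr => //; case: Pp.
Qed.

End StableEq.

Lemma stable_PEP_eqcrit (A B : comPzRingType) (f : A -> B) (P : A -> Prop) :
  ring_hom f -> stable_PEP f -> prime_ideal P -> eqcrit_mod f P.
Proof.
move=> hf fS Pp J r s.
have [L [k [[hk _ _ _] kP]]] := residue_field_exists Pp.
have reix (V : zmodType) (G : J -> V) : \sum_j G j = \sum_(i < #|J|) G (enum_val i).
  by rewrite (reindex _ (onW_bij _ (@enum_val_bij J))).
rewrite reix => /(stable_PEP_eqcrit_ord hf fS Pp hk kP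
  (r := fun i => r (enum_val i)) (s := fun i => s (enum_val i))) [K [sg [c [e h]]]].
exists K, sg, (fun k j => c k (enum_rank j)); split=> [j|i].
  by rewrite -e enum_rankK.
by rewrite reix; under eq_bigr => j _ do rewrite enum_valK.
Qed.

(** * From primes to finite intersections of primes *)

Lemma eqcrit_modI (A B : comPzRingType) (f : A -> B) (I J : A -> Prop) : ring_hom f ->
  is_ideal I -> eqcrit_mod f I -> eqcrit_mod f J -> eqcrit_mod f (fun a => I a /\ J a).
Proof.
move=> hf Ii fI fJ T r s hrs.
have [K [sg [c [e h]]]] := fI T r s (ext_mono (fun a => @proj1 _ _) hrs).
have := fJ K (fun k => \sum_j r j * c k j) sg.
have -> : \sum_k f (\sum_j r j * c k j) * sg k = \sum_j f (r j) * s j.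
  under [RHS]eq_bigr => j _ do rewrite e mulr_sumr.
  rewrite [RHS]exchange_big; apply: eq_bigr => k _.
  rewrite (ring_hom_sum hf) mulr_suml; apply: eq_bigr => j _.
  by rewrite (ring_homM hf); ring.
case/(_ (ext_mono (fun a => @proj2 _ _) hrs)) => [M [ta [d [e' h']]]].
(* The value of a new relation is a combination of the old values, so it stays in [I]; it lies in
   [J] by the choice of [d]. *)
have E m : \sum_j r j * (\sum_k d m k * c k j) = \sum_k (\sum_j r j * c k j) * d m k.
  under eq_bigr => j _ do rewrite mulr_sumr.
  rewrite exchange_big; apply: eq_bigr => k _; rewrite mulr_suml.
  by apply: eq_bigr => j _; ring.
exists M, ta, (fun m j => \sum_k d m k * c k j); split=> [j|m].
  rewrite e; under eq_bigr => k _ do rewrite e' mulr_suml.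
  rewrite exchange_big; apply: eq_bigr => m _.
  rewrite (ring_hom_sum hf) mulr_sumr; apply: eq_bigr => k _.
  by rewrite (ring_homM hf) mulrA.
rewrite E; split; last exact: h'.
by apply: ideal_sum => // k _; apply: ideal_mulr.
Qed.

Lemma eqcrit_mod_ext (A B : comPzRingType) (f : A -> B) (I J : A -> Prop) :
  (forall a, I a <-> J a) -> eqcrit_mod f I -> eqcrit_mod f J.
Proof. by move=> e; have -> : I = J by apply: funext => a; apply: propext. Qed.

Lemma stable_PEP_eqcrit_int (A B : comPzRingType) (f : A -> B) (J : A -> Prop) :
  ring_hom f -> stable_PEP f -> finite_int_primes J -> eqcrit_mod f J.
Proof.
move=> hf fS [[|P Ps] [ne [hPs hJ]]]; first by case: ne.
suff [_ h] : is_ideal (fun x => forall Q, List.In Q (P :: Ps) -> Q x) /\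
    eqcrit_mod f (fun x => forall Q, List.In Q (P :: Ps) -> Q x).
  by apply: eqcrit_mod_ext h => a; apply: iff_sym.
clear hJ ne; elim: Ps P hPs => [|P' Ps IH] P hPs.
  have -> : (fun x => forall Q, List.In Q [:: P] -> Q x) = P.
    apply: funext => x; apply: propext; split=> [h|Px Q [e|[]]]; last by rewrite -e.
    by apply: h; left.
  have Pp := hPs P (or_introl erefl).
  by split; [case: Pp | apply: stable_PEP_eqcrit].
have Pp := hPs P (or_introl erefl).
have [|[I0 ID IM] hE] := IH P'; first by move=> Q hQ; apply: hPs; right.
have -> : (fun x => forall Q, List.In Q [:: P, P' & Ps] -> Q x) =
    (fun x => P x /\ forall Q, List.In Q (P' :: Ps) -> Q x).
  apply: funext => x; apply: propext; split=> [h|[h1 h2] Q [e|]]; [|by rewrite -e|exact: h2].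
  by split=> [|Q hQ]; apply: h; [left | right].
split; last by apply: eqcrit_modI => //; [case: Pp | apply: stable_PEP_eqcrit].
have [[P0 PD PM] _ _] := Pp; split=> //.
- by move=> x y [? ?] [? ?]; split; [apply: PD | apply: ID].
- by move=> x y [? ?]; split; [apply: PM | apply: IM].
Qed.

Lemma eqcrit_quotient (A B : comPzRingType) (f : A -> B) (I : A -> Prop)
    (Q1 Q2 : comPzRingType) (q1 : A -> Q1) (q2 : B -> Q2) (fb : Q1 -> Q2) :
  is_quotient I q1 -> is_quotient (ext_ideal f I) q2 -> (forall a, fb (q1 a) = q2 (f a)) ->
  ring_hom f -> eqcrit_mod f I -> eqcrit fb.
Proof.
move=> [h1 s1 k1] [h2 s2 k2] hfb hf fI J r s.
have [r' rE] : exists r' : J -> A, forall j, q1 (r' j) = r j.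
  by exists (fun j => sval (cid (s1 (r j)))) => j; case: cid.
have [s' sE] : exists s' : J -> B, forall j, q2 (s' j) = s j.
  by exists (fun j => sval (cid (s2 (s j)))) => j; case: cid.
under eq_bigr => j _ do rewrite -rE -sE hfb -(ring_homM h2).
rewrite -(ring_hom_sum h2) => /k2 /fI [K [sg [c [e h]]]].
exists K, (fun k => q2 (sg k)), (fun k j => q1 (c k j)); split=> [j|k].
  rewrite -sE e (ring_hom_sum h2); apply: eq_bigr => k _.
  by rewrite (ring_homM h2) hfb.
under eq_bigr => j _ do rewrite -rE -(ring_homM h1).
by rewrite -(ring_hom_sum h1); apply/k1.
Qed.
(** * Fibers of a map with the stable prime extension property *)

Section TensorAlg.
Variables (A B C T : comPzRingType) (f : A -> B) (g : A -> C) (i : B -> T) (j : C -> T).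
Hypothesis ht : is_tensor_alg f g i j.

Lemma tensor_alg_lift (D : comPzRingType) (u : B -> D) (v : C -> D) :
  ring_hom u -> ring_hom v -> (forall a, u (f a) = v (g a)) ->
  exists w : T -> D, [/\ ring_hom w, (forall b, w (i b) = u b) & (forall c, w (j c) = v c)].
Proof. by move=> hu hv huv; case: ht => _ _ _ /(_ D u v hu hv huv) [w [hw _]]; exists w. Qed.

Lemma tensor_alg_ext (D : comPzRingType) (w w' : T -> D) : ring_hom w -> ring_hom w' ->
  (forall b, w (i b) = w' (i b)) -> (forall c, w (j c) = w' (j c)) -> w =1 w'.
Proof.
move=> hw hw' ei ej x; have [hi hj e] := ht.
case/(_ D _ _ (ring_hom_comp hi hw) (ring_hom_comp hj hw)) => [a|v [_ vu]].
  by rewrite e.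
have <- : v = w by apply: vu.
by have <- : v = w' by apply: vu; split=> // ?; rewrite ?ei ?ej.
Qed.

End TensorAlg.

Section TensorDomain.
Variables (A B C : comPzRingType) (f : A -> B) (g : A -> C).
Hypotheses (hf : ring_hom f) (hg : ring_hom g) (fS : stable_PEP f) (Cd : is_domain C).

(* A relation [x y = 0] involves finitely many elements [m] of [C].  Sending variables [X_m] to
   them gives a prime [Q] of [A[X]]; the relation says that a product of linear forms over [B]
   lies in [Q B[X]]. *)
Lemma stable_PEP_tring_domain (x y : tring f hg) : x * y = 0 -> x = 0 \/ y = 0.
Proof.
have [lx xE] := tring_span x; have [ly yE] := tring_span y => xy0.
pose T := tring f hg; pose M : lmodType A := algmod hg.
pose l : seq (M * B) := @mull A B C g hg lx ly.
have : bsum (tring_pure f hg : M -> B -> T) l = 0.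
  rewrite bsum_mull -[RHS]xy0 xE yE mulr_suml; apply: eq_bigr => z _.
  by rewrite mulr_sumr; apply: eq_bigr => z' _; rewrite tring_pureM.
move=> /(tensor_mod_eq0 (tring_mod f hg)) /(vanishing hf) [K [sg [c [crel cE]]]].
(* One variable for each element of [C] occurring in the factors, in their formal product, or in the
   relations that make the product vanish. *)
pose D : seq C := unzip1 lx ++ unzip1 ly ++ unzip1 l ++ flatten [seq unzip1 (c k) | k <- enum K].
pose n := size D.
have [PA [PB [cA [XA [cB [XB [F [hPA hPB hF Fc FX]]]]]]]] := poly_map_exists hf n.
have hcA := polyring_hom hPA; have hcB := polyring_hom hPB.
pose var (R : comPzRingType) (X : 'I_n -> R) (m : C) : R :=
  if insub (index m D) is Some i then X i else 0.
have [th [hth thc thX]] := polyring_map hPA (fun i => nth 0 D i) hg.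
have [hi hj hij _] := tring_is_tensor_alg f hg.
have [thB [hthB thBc thBX]] := polyring_map hPB (fun i => tring_pure f hg (nth 0 D i) 1) hj.
have th_var m : m \in D -> th (var PA XA m) = m.
  move=> mD; rewrite /var; case: insubP => [i _ ie|]; last by rewrite index_mem mD.
  by rewrite thX ie nth_index.
have thB_var m : m \in D -> thB (var PB XB m) = tring_pure f hg m 1.
  move=> mD; rewrite /var; case: insubP => [i _ ie|]; last by rewrite index_mem mD.
  by rewrite thBX ie nth_index.
have F_var m : F (var PA XA m) = var PB XB m.
  by rewrite /var; case: insub => [i|]; rewrite ?FX ?(ring_hom0 hF).
pose Q q := th q = 0.
have Qp : prime_ideal Q by apply: prime_ker.
have thBF q : thB (F q) = tring_pure f hg (th q) 1.
  apply: (polyring_ext hPA (ring_hom_comp hF hthB) (ring_hom_comp hth hi)).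
  - by move=> a; rewrite Fc thBc thc -hij.
  - by move=> i; rewrite FX thBX thX.
have thBQ p : ext_ideal F Q p -> thB p = 0.
  move: p; apply: ext_min; first exact: ideal_ker.
  by move=> q Qq; rewrite thBF Qq (ring_hom0 hi).
have QBi := ext_ideal_is_ideal F Q; have [_ QD QM] := QBi.
pose lift (s : seq (C * B)) : PB := \sum_(z <- s) cB z.2 * var PB XB z.1.
have thB_lift s : {subset unzip1 s <= D} -> thB (lift s) = \sum_(z <- s) tring_pure f hg z.1 z.2.
  move=> sD; rewrite /lift (ring_hom_sum hthB) big_seq [RHS]big_seq; apply: eq_bigr => z zs.
  rewrite (ring_homM hthB) thBc thB_var ?tring_pureM ?mul1r ?mulr1 //.
  by apply: sD; apply: map_f.
have lxD : {subset unzip1 lx <= D} by move=> m hm; rewrite mem_cat hm.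
have lyD : {subset unzip1 ly <= D} by move=> m hm; rewrite !mem_cat hm orbT.
have lD : {subset unzip1 l <= D} by move=> m hm; rewrite !mem_cat hm !orbT.
have cD k : {subset unzip1 (c k) <= D}.
  move=> m hm; rewrite !mem_cat; do 3!(apply/orP; right).
  by apply/flatten_mapP; exists k; rewrite ?mem_enum.
pose S := undup D.
have Su : uniq S by apply: undup_uniq.
have lQ : ext_ideal F Q (lift l).
  have -> : lift l = \sum_k cB (sg k) * F (\sum_(m <- S) cA (fs (c k) m) * var PA XA m).
    rewrite /lift (@fs_regroup _ _ _ (fun m b => cB b * var PB XB m) l S) //; last first.
    - by move=> m hm; rewrite mem_undup; apply: lD.
    - by move=> m b b'; rewrite (ring_homD hcB) mulrDl.
    under eq_bigr => m _ do rewrite cE (ring_hom_sum hcB) mulr_suml.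
    rewrite exchange_big; apply: eq_bigr => k _ /=.
    rewrite (ring_hom_sum hF) mulr_sumr; apply: eq_bigr => m _.
    by rewrite (ring_homM hcB) (ring_homM hF) Fc F_var mulrA.
  apply: ideal_sum => // k _; apply: (QM); apply: ext_gen.
  have E : \sum_(m <- S) g (fs (c k) m) * m = 0 :> C.
    apply: etrans (crel k); rewrite (@fs_regroup _ _ _ (fun (m : M) a => a *: m) (c k) S) //.
      by move=> m a a'; rewrite scalerDl.
    by move=> m hm; rewrite mem_undup; apply: (cD k).
  rewrite /Q (ring_hom_sum hth); apply: etrans E.
  by apply: eq_big_seq => m mS; rewrite (ring_homM hth) thc th_var // -mem_undup.
(* The product of the two linear forms is quadratic, while [lift l] is linear; they differ by
   multiples of X_m X_m' - X_(m m'), which lie in [Q]. *)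
have xyQ : ext_ideal F Q (lift lx * lift ly).
  pose r (z z' : C * B) := cB (z.2 * z'.2) *
    F (var PA XA z.1 * var PA XA z'.1 - var PA XA (z.1 * z'.1)).
  have -> : lift lx * lift ly = (\sum_(z <- lx) \sum_(z' <- ly) r z z') + lift l.
    rewrite /lift /l /mull big_allpairs_dep -big_split mulr_suml; apply: eq_bigr => z _.
    rewrite mulr_sumr -big_split; apply: eq_bigr => z' _ /=.
    by rewrite /r (ring_homB hF) (ring_homM hF) !F_var (ring_homM hcB); ring.
  apply: (QD) => //; rewrite big_seq; apply: ideal_sum => // z hz.
  rewrite big_seq; apply: ideal_sum => // z' hz'.
  apply: (QM); apply: ext_gen; rewrite /Q (ring_homB hth) (ring_homM hth) !th_var ?subrr //.
  - apply: lD; rewrite /unzip1 /l /mull.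
    by apply/mapP; exists (z.1 * z'.1, z.2 * z'.2) => //; apply/allpairsP; exists (z, z').
  - by apply: lyD; apply: map_f.
  - by apply: lxD; apply: map_f.
have : ext_ideal F Q (lift lx) \/ ext_ideal F Q (lift ly).
  case: (fS hPA hPB hF Fc FX Qp) => [[_ _]|h1]; first exact.
  by left; apply: ideal1_all h1.
by case=> /thBQ; rewrite thB_lift // -?xE -?yE; auto.
Qed.

End TensorDomain.

(** * Tensor products over a field *)

Section TensorField.
Variables (K F : comPzRingType) (e : K -> F).
Hypotheses (he : ring_hom e) (Ku : forall x : K, x = 0 \/ unitP x).

(** When r_j0 is a unit, the vectors e_j - (r_j / r_j0) e_j0 are relations. Combining them with
    coefficients s_j gives s, because the correction at j0 is a multiple of sum_j r_j s_j = 0. *)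
Lemma field_eqcrit : eqcrit e.
Proof.
move=> J r s rs0.
have [r0|/existsNP [j0 hj0]] := pselect (forall j, r j = 0).
  apply: (relspan_ext (s := fun i => \sum_j s j * e (j == i)%:R)).
    move=> i; rewrite (bigD1 i) //= eqxx (ring_hom1 he) mulr1 big1 ?addr0 // => j /negbTE ->.
    by rewrite (ring_hom0 he) mulr0.
  by apply: relspan_sum => j; apply: relspan_gen; apply: big1 => i _; rewrite r0 mul0r.
have [//|[u hu]] := Ku (r j0).
apply: (relspan_ext (s := fun i => \sum_j s j * e ((j == i)%:R - r j * u * (j0 == i)%:R))).
  move=> i.
  have e1 : \sum_j s j * e (j == i)%:R = s i.
    rewrite (bigD1 i) //= eqxx (ring_hom1 he) mulr1 big1 ?addr0 // => j /negbTE ->.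
    by rewrite (ring_hom0 he) mulr0.
  have e2 : \sum_j e (r j) * s j * e (u * (j0 == i)%:R) = 0 by rewrite -mulr_suml rs0 mul0r.
  rewrite -[s i]subr0; apply: etrans (congr2 (fun x y => x - y) e1 e2); rewrite -sumrB.
  by apply: eq_bigr => j _; rewrite (ring_homB he) -mulrA !(ring_homM he); ring.
have pick (j : J) (G : J -> K) : \sum_i G i * (j == i)%:R = G j.
  rewrite (bigD1 j) //= eqxx mulr1 big1 ?addr0 // => i ne.
  by rewrite eq_sym (negbTE ne) mulr0.
apply: relspan_sum => j; apply: relspan_gen.
under eq_bigr => i _ do rewrite mulrBr mulrCA.
by rewrite sumrB pick -mulr_sumr pick mulrAC -mulrA hu mulr1 subrr.
Qed.

(** If 1 (x) 1 vanished, [vanishing_eqcrit] would write 1 in [F] through scalars c with c 1 = 0 in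
    [L]. A unit c would make [L] zero, so all c are 0 and [F] would be zero. *)
Lemma tensor_field_neq0 (L : comPzRingType) (l : K -> L) (U : comPzRingType)
    (i : L -> U) (j : F -> U) : ring_hom l ->
  is_tensor_alg l e i j -> (1 : L) <> 0 -> (1 : F) <> 0 -> (1 : U) <> 0.
Proof.
move=> hl ht L1 F1 U0.
have [hi hj hij _] := tring_is_tensor_alg e hl.
have [w [hw _ _]] := tensor_alg_lift ht hi hj hij.
pose M : lmodType K := algmod hl.
have : bsum (tring_pure e hl : M -> F -> _) [:: ((1 : L) : M, 1)] = 0.
  by rewrite /bsum big_seq1 -[LHS]/(1 : tring e hl) -(ring_hom1 hw) U0 (ring_hom0 hw).
move=> /(tensor_mod_eq0 (tring_mod e hl)) /(vanishing_eqcrit he field_eqcrit).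
move=> [J [sg [c [h1 h2]]]].
have := h1 (1 : L); rewrite /fs big_seq1 /delta /= eqxx big1 // => k _.
have := h2 k; rewrite /= big_seq1 algmod_scaleE mulr1.
have [->|[u hu] lc] := Ku (c k (1 : L)); first by rewrite (ring_hom0 he) mulr0.
by case: L1; rewrite -(ring_hom1 hl) -hu (ring_homM hl) lc mul0r.
Qed.

End TensorField.

(** By transitivity L (x)_K (K (x)_R S) is L (x)_R S, which [stable_PEP_tring_domain] controls. The
    identity [phi (psi x) = x] makes [psi] injective and so transfers the absence of zero
    divisors. *)
Theorem stable_PEP_fibers (R S : comPzRingType) (h : R -> S) : ring_hom h ->
  stable_PEP h -> fibers_geom_red_irr h.
Proof.
move=> hh hS P Pp K k resk F iK jB tF F1 L l hl U i j tU.
have Ku := residue_field_inv Pp resk.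
have [hk _ _ _] := resk.
have [hiK hjB ejB _] := tF; have [hi hj eij _] := tU.
have [L1 Ld] := field_is_domain L.
split; first exact: (tensor_field_neq0 hiK Ku hl tU).
have hg := ring_hom_comp hk hl.
have tT := tring_is_tensor_alg h hg; have [hiT hjT eT _] := tT.
have [b [hb bi bj]] := tensor_alg_lift tF (ring_hom_comp hl hiT) hjT eT.
have [psi [hpsi psii psij]] := tensor_alg_lift tU hiT hb (fun x => esym (bi x)).
have [|phi [hphi phii phij]] := tensor_alg_lift tT hi (ring_hom_comp hjB hj).
  by move=> a; rewrite eij ejB.
have phipsi x : phi (psi x) = x.
  apply: (tensor_alg_ext tU (ring_hom_comp hpsi hphi) (@ring_hom_id U)) => [z|c].
    by rewrite psii phii.
  rewrite psij.
  apply: (tensor_alg_ext tF (ring_hom_comp hb hphi) hj) => [z|s].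
    by rewrite bi phii eij.
  by rewrite bj phij.
move=> x y xy.
have : psi x * psi y = 0 by rewrite -(ring_homM hpsi) xy (ring_hom0 hpsi).
case/(stable_PEP_tring_domain hh hS (field_is_domain L)) => e; [left | right].
  by rewrite -(phipsi x) e (ring_hom0 hphi).
by rewrite -(phipsi y) e (ring_hom0 hphi).
Qed.
(** * Passage to quotients *)

Section Square.
Variables (A B A' B' : comPzRingType) (f : A -> B) (f' : A' -> B') (al : A -> A') (be : B -> B').
Hypotheses (hal : ring_hom al) (hbe : ring_hom be)
  (al_surj : forall y, exists x, al x = y) (be_surj : forall y, exists x, be x = y)
  (sq : forall a, be (f a) = f' (al a)).
Variables (P : A -> Prop) (P' : A' -> Prop).
Hypotheses (PP' : forall a, P a <-> P' (al a)) (kbe : forall b, be b = 0 -> ext_ideal f P b).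

Lemma square_prime : prime_ideal P <-> prime_ideal P'.
Proof.
split=> [[[P0 PD PM] P1 Pp]|hP']; last first.
  have -> : P = (fun a => P' (al a)) by apply: funext => a; apply: propext.
  exact: prime_preim.
split; first split.
- by rewrite -(ring_hom0 hal); apply/PP'.
- move=> x y; have [x' <-] := al_surj x; have [y' <-] := al_surj y.
  by rewrite -(ring_homD hal) -!PP'; apply: PD.
- move=> x y; have [x' <-] := al_surj x; have [y' <-] := al_surj y.
  by rewrite -(ring_homM hal) -!PP'; apply: PM.
- by rewrite -(ring_hom1 hal) -PP'.
- move=> x y; have [x' <-] := al_surj x; have [y' <-] := al_surj y.
  by rewrite -(ring_homM hal) -!PP'; apply: Pp.
Qed.

(** The extension of [P] contains the kernel of [be], so membership does not depend on the lift
    chosen along [be]. *)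
Lemma square_ext b : ext_ideal f P b <-> ext_ideal f' P' (be b).
Proof.
split.
- move: b; apply: ext_min.
    exact: ideal_preim (ext_ideal_is_ideal f' P').
  by move=> a /PP' h; rewrite sq; apply: ext_gen.
- have [_ eD eM] := ext_ideal_is_ideal f P.
  suff h y : ext_ideal f' P' y -> exists2 x, ext_ideal f P x & be x = y.
    case/h => x hx e; rewrite -(subrK x b); apply: eD => //; apply: kbe.
    by rewrite (ring_homB hbe) e subrr.
  move: y; apply: ext_min.
    split; first by exists 0; [case: (ext_ideal_is_ideal f P) | exact: ring_hom0].
      move=> _ _ [x hx <-] [y hy <-]; exists (x + y); last exact: ring_homD.
      exact: eD.
    move=> r _ [x hx <-]; have [r' <-] := be_surj r.
    by exists (r' * x); [exact: eM | exact: ring_homM].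
  move=> a'; have [a <-] := al_surj a' => /PP' h.
  by exists (f a); [exact: ext_gen | exact: sq].
Qed.

End Square.

Section SquarePEP.
Variables (A B A' B' : comPzRingType) (f : A -> B) (f' : A' -> B') (al : A -> A') (be : B -> B').
Hypotheses (hal : ring_hom al) (hbe : ring_hom be)
  (al_surj : forall y, exists x, al x = y) (be_surj : forall y, exists x, be x = y)
  (sq : forall a, be (f a) = f' (al a)).
Variables (P : A -> Prop) (P' : A' -> Prop).
Hypotheses (PP' : forall a, P a <-> P' (al a)) (kbe : forall b, be b = 0 -> ext_ideal f P b).

Lemma square_PEP :
  prime_ideal (ext_ideal f P) \/ ext_ideal f P 1 <->
  prime_ideal (ext_ideal f' P') \/ ext_ideal f' P' 1.
Proof.
have E := square_ext hbe al_surj be_surj sq PP' kbe.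
by rewrite E (ring_hom1 hbe) (square_prime hbe be_surj E).
Qed.

End SquarePEP.

Section PolyQuotient.
Variables (A A' : comPzRingType) (I : A -> Prop) (q : A -> A').
Hypothesis hq : is_quotient I q.
Variables (n : nat) (P P' : comPzRingType) (c : A -> P) (X : 'I_n -> P)
  (c' : A' -> P') (X' : 'I_n -> P') (al : P -> P').
Hypotheses (hP : is_polyring c X) (hP' : is_polyring c' X') (hal : ring_hom al)
  (alc : forall a, al (c a) = c' (q a)) (alX : forall i, al (X i) = X' i).

(** For the kernel, the model quotient of [P] by the extension of [I] receives a map from [P'],
    built from the universal properties of [A'] and [P']. Hence what [al] kills is already zero in
    that quotient. *)
Lemma polyring_quotient : is_quotient (ext_ideal c I) al.
Proof.
have [qh qs qI] := hq.
split=> //.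
- elim/(polyring_ind hP') => [a|i|x y [x' <-] [y' <-]|x y [x' <-] [y' <-]].
  + by have [a' <-] := qs a; exists (c a').
  + by exists (X i).
  + by exists (x' + y'); exact: ring_homD.
  + by exists (x' * y'); exact: ring_homM.
- move=> x; split; last first.
    move: x; apply: ext_min; first exact: ideal_ker.
    by move=> a Ia; rewrite alc (proj2 (qI a)) // (ring_hom0 (polyring_hom hP')).
  have [E [p hp]] := quotient_exists (ext_ideal_is_ideal c I).
  have [ph ps pI] := hp.
  have [|v [hv vq]] := quotient_lift hq (ring_hom_comp (polyring_hom hP) ph).
    by move=> a Ia; apply/pI; apply: ext_gen.
  have [w [hw wc wX]] := polyring_map hP' (fun i => p (X i)) hv.
  have e : p x = w (al x).
    apply: (polyring_ext hP ph (ring_hom_comp hal hw)) => [a|i].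
      by rewrite alc wc vq.
    by rewrite alX wX.
  by move=> h; apply/pI; rewrite e h (ring_hom0 hw).
Qed.

End PolyQuotient.

Lemma stable_PEP_quotient (R S : comPzRingType) (h : R -> S) (I : R -> Prop) : ring_hom h ->
  stable_PEP h -> on_quotient_map h I (fun Q1 Q2 fb => stable_PEP fb).
Proof.
move=> hh hS Q1 q1 Q2 q2 fb hq1 hq2 hfb fbq n PA cA XA PB cB XB F hPA hPB hF Fc FX P' hP'.
have [q1h q1s q1I] := hq1; have [q2h q2s q2I] := hq2.
have [PR [PS [cR [XR [cS [XS [H [hPR hPS hH Hc HX]]]]]]]] := poly_map_exists hh n.
have [al [hal alc alX]] := polyring_map hPR XA (ring_hom_comp q1h (polyring_hom hPA)).
have [be [hbe bec beX]] := polyring_map hPS XB (ring_hom_comp q2h (polyring_hom hPB)).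
have [_ als _] := polyring_quotient hq1 hPR hPA hal alc alX.
have [_ bes bek] := polyring_quotient hq2 hPS hPB hbe bec beX.
have sq a : be (H a) = F (al a).
  apply: (polyring_ext hPR (ring_hom_comp hH hbe) (ring_hom_comp hal hF)) => [r|i].
    by rewrite Hc bec alc Fc fbq.
  by rewrite HX beX alX FX.
pose P a := P' (al a).
apply/(square_PEP (P := P) hbe als bes sq (fun a => iff_refl _)); last first.
  by apply: (hS _ _ _ _ _ _ _ _ hPR hPS hH Hc HX); apply: prime_preim.
move=> b /bek; move: b.
have hcS := polyring_hom hPS.
apply: ext_min; first exact: ext_ideal_is_ideal.
apply: ext_min.
  exact: ideal_preim (ext_ideal_is_ideal H P).
move=> a Ia; rewrite -Hc; apply: ext_gen; rewrite /P alc (proj2 (q1I a)) //.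
by rewrite (ring_hom0 (polyring_hom hPA)); case: hP' => -[].
Qed.

Lemma quotient_map_exists (R S : comPzRingType) (h : R -> S) (I : R -> Prop) : ring_hom h ->
  is_ideal I ->
  exists (Q1 : comPzRingType) (q1 : R -> Q1) (Q2 : comPzRingType) (q2 : S -> Q2) (fb : Q1 -> Q2),
  [/\ is_quotient I q1, is_quotient (ext_ideal h I) q2, ring_hom fb &
     forall a, fb (q1 a) = q2 (h a)].
Proof.
move=> hh Ii; have [Q1 [q1 hq1]] := quotient_exists Ii.
have [Q2 [q2 hq2]] := quotient_exists (ext_ideal_is_ideal h I).
have [q2h _ q2I] := hq2.
have [|fb [hfb fbq]] := quotient_lift hq1 (ring_hom_comp hh q2h).
  by move=> a Ia; apply/q2I; apply: ext_gen.
by exists Q1, q1, Q2, q2, fb.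
Qed.

Lemma nilradical_prime (A : comPzRingType) (P : A -> Prop) x :
  prime_ideal P -> nilradical x -> P x.
Proof.
move=> [[P0 PD PM] P1 Pp] [n]; elim: n => [|n IH]; first by rewrite expr0 => e; case: P1; rewrite e.
have h m : P (x ^+ m) -> P x.
  by elim: m => [|m IHm]; rewrite ?expr0 // exprS => /Pp [].
by move=> e; apply: (h n.+1); rewrite e.
Qed.

Lemma nilradical_ideal (A : comPzRingType) : is_ideal (@nilradical A).
Proof.
split; first by exists 1%N; rewrite expr1.
- move=> x y [n xn] [m ym]; exists (n + m)%N; rewrite exprDn big1 // => i _.
  have [le|lt] := leqP m i.
    by rewrite -(subnK le) exprD ym !mulr0 mul0rn.
  have le : (n <= n + m - i)%N by rewrite -addnBA ?leq_addr // ltnW.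
  by rewrite -(subnK le) exprD xn mulr0 mul0r mul0rn.
- by move=> r x [n xn]; exists n; rewrite exprMn xn mulr0.
Qed.

(** A prime of R[X] contains all nilpotents, so it is the full preimage of its image over the
    reduced ring, and [square_PEP] compares the two extensions. *)
Lemma stable_PEP_of_nilquotient (R S : comPzRingType) (h : R -> S) : ring_hom h ->
  on_quotient_map h (@nilradical R) (fun Q1 Q2 fb => stable_PEP fb) -> stable_PEP h.
Proof.
move=> hh hN n PR cR XR PS cS XS H hPR hPS hH Hc HX P Pp.
have [Q1 [q1 [Q2 [q2 [fb [hq1 hq2 hfb fbq]]]]]] := quotient_map_exists hh (nilradical_ideal R).
have [q1h q1s q1I] := hq1; have [q2h q2s q2I] := hq2.
have [PA [PB [cA [XA [cB [XB [F [hPA hPB hF Fc FX]]]]]]]] := poly_map_exists hfb n.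
have [al [hal alc alX]] := polyring_map hPR XA (ring_hom_comp q1h (polyring_hom hPA)).
have [be [hbe bec beX]] := polyring_map hPS XB (ring_hom_comp q2h (polyring_hom hPB)).
have hqa := polyring_quotient hq1 hPR hPA hal alc alX; have [_ als alk] := hqa.
have [_ bes bek] := polyring_quotient hq2 hPS hPB hbe bec beX.
have sq a : be (H a) = F (al a).
  apply: (polyring_ext hPR (ring_hom_comp hH hbe) (ring_hom_comp hal hF)) => [r|i].
    by rewrite Hc bec alc Fc fbq.
  by rewrite HX beX alX FX.
have Pi : is_ideal P by case: Pp.
have NP a : ext_ideal cR (@nilradical R) a -> P a.
  move: a; apply: ext_min => // a [m am]; apply: nilradical_prime => //; exists m.
  by rewrite -(ring_homX (polyring_hom hPR)) am (ring_hom0 (polyring_hom hPR)).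
pose P' y := exists2 a, P a & al a = y.
have PP' a : P a <-> P' (al a).
  split=> [|[b Pb /(quotient_eq hqa) /NP ba]]; first by exists a.
  by have [_ PD _] := Pi; rewrite -[a](subKr b); apply: PD => //; apply: ideal_opp.
have kbe b : be b = 0 -> ext_ideal H P b.
  move=> /bek; move: b.
  have hcS := polyring_hom hPS.
  apply: ext_min; first exact: ext_ideal_is_ideal.
  apply: ext_min.
    exact: ideal_preim (ext_ideal_is_ideal H P).
  by move=> a Na; rewrite -Hc; apply: ext_gen; apply: NP; apply: ext_gen.
apply/(square_PEP hbe als bes sq PP' kbe).
apply: (hN _ _ _ _ _ hq1 hq2 hfb fbq _ _ _ _ _ _ _ _ hPA hPB hF Fc FX).
exact/(square_prime hal als PP').
Qed.

(** * Flatness modulo the minimal primes *)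

Lemma minimal_prime_exists (A : comPzRingType) (P : A -> Prop) : prime_ideal P ->
  exists Q, minimal_prime Q /\ forall x, Q x -> P x.
Proof.
move=> Pp.
pose T := {Q : A -> Prop | prime_ideal Q /\ forall x, Q x -> P x}.
pose le (s t : T) := `[< forall x, sval t x -> sval s x >].
have [||||[Q [Qp QP]] Qmin] := @classical_sets.Zorn T le.
- by move=> s; apply/asboolP.
- by move=> r s t /asboolP h1 /asboolP h2; apply/asboolP => x /h2 /h1.
- move=> [s hs] [t ht] /asboolP /= h1 /asboolP /= h2; apply: eq_exist.
  by apply: funext => x; apply: propext; split=> [/h2|/h1].
- move=> C Ctot.
  (* The conjunct [P x] makes the bound a proper ideal below [P] even for the empty chain. *)
  pose I x := P x /\ forall t, C t -> sval t x.
  have [[P0 PD PM] P1 Ppr] := Pp.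
  have Tp (t : T) : prime_ideal (sval t) by have [] := svalP t.
  have TP (t : T) x : sval t x -> P x by have [_] := svalP t; apply.
  have Ip : prime_ideal I.
    split; first split.
    - by split=> // t _; have [[] ] := Tp t.
    - move=> x y [Px Cx] [Py Cy]; split; first exact: PD.
      by move=> t Ct; have [[_ tD _] _ _] := Tp t; apply: tD; [apply: Cx | apply: Cy].
    - move=> r x [Px Cx]; split; first exact: PM.
      by move=> t Ct; have [[_ _ tM] _ _] := Tp t; apply: tM; apply: Cx.
    - by case.
    - move=> a b [Pab Cab].
      have [aI|aI] := pselect (I a); first by left.
      (* A member [s] missing [a] must contain [b]. Members above [s] then contain [b], and members
         below [s] also miss [a], so they contain [b] by primality. *)
      right; have [na|[s Cs na]] : ~ P a \/ exists2 s, C s & ~ sval s a.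
      + have [Pa|] := pselect (P a); last by left.
        right; apply: contrapT => h; apply: aI; split=> // t Ct.
        by apply: contrapT => hta; apply: h; exists t.
      + have bt t : C t -> sval t b.
          by move=> Ct; case: (Tp t) => _ _ /(_ _ _ (Cab t Ct)) [/TP|].
        by split=> //; case: (Ppr _ _ Pab).
      + have bs : sval s b by case: (Tp s) => _ _ /(_ _ _ (Cab s Cs)) [].
        split=> [|t Ct]; first exact: TP bs.
        have [/asboolP h|/asboolP h] := Ctot _ _ Cs Ct; last exact: h.
        by case: (Tp t) => _ _ /(_ _ _ (Cab t Ct)) [/h|].
  exists (exist _ I (conj Ip (fun x (h : I x) => proj1 h))) => s Cs.
  by apply/asboolP => x /= [_]; apply.
exists Q; split=> //; split=> // Q' Q'p Q'Q x Qx.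
have h : prime_ideal Q' /\ forall x, Q' x -> P x by split=> // y /Q'Q /QP.
have : exist _ Q' h = exist _ Q (conj Qp QP) :> T.
  by apply: Qmin; apply/asboolP.
by case=> ->.
Qed.

Lemma flat_stable_PEP (R S : comPzRingType) (h : R -> S) : ring_hom h ->
  fibers_geom_red_irr h ->
  (forall P, minimal_prime P -> on_quotient_map h P (fun Q1 Q2 fb => flat fb)) ->
  stable_PEP h.
Proof.
move=> hh hfib hflat n PA cA XA PB cB XB F hPA hPB hF Fc FX Q Qp.
have hcA := polyring_hom hPA; have hcB := polyring_hom hPB.
have pp := prime_preim hcA Qp; set p := (fun x => Q (cA x)) in pp.
have [P [Pmin Pp]] := minimal_prime_exists pp.
have Pprime := Pmin.1; have Pi : is_ideal P by case: Pprime.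
have [Q1 [q1 [Q2 [q2 [fb [hq1 hq2 hfb fbq]]]]]] := quotient_map_exists hh Pi.
have fbflat := hflat P Pmin _ _ _ _ _ hq1 hq2 hfb fbq.
have [q1h q1s q1I] := hq1; have [q2h q2s q2I] := hq2.
have Qi : is_ideal Q by case: Qp.
have [E [e he]] := quotient_exists Qi; have [eh es eI] := he.
have [L [ell [[ellh _ _ _] ellQ]]] := residue_field_exists Qp.
have [io [ioh ioe]] := quotient_lift he ellh (fun x => proj2 (ellQ x)).
have io_inj : injective io.
  move=> x y; have [x' <-] := es x; have [y' <-] := es y.
  rewrite !ioe => exy; apply/(quotient_eq he)/ellQ.
  by rewrite (ring_homB ellh) exy subrr.
have [|g1 [g1h g1q]] := quotient_lift hq1 (ring_hom_comp hcA eh).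
  by move=> a /Pp ha; apply/eI.
have gLh := ring_hom_comp g1h ioh; set gL := (fun x => io (g1 x)) in gLh.
have gLq a : gL (q1 a) = ell (cA a) by rewrite /gL g1q ioe.
(* [T1 = R[X]/Q (x) S/PS], which is [S[X]/Q S[X]], and [T2 = L (x) S/PS] with [L] the fraction
   field of [R[X]/Q]. *)
pose T1 := tring fb g1h; pose T2 := tring fb gLh.
have t1 := tring_is_tensor_alg fb g1h; have [i1 j1 e1 _] := t1.
have t2 := tring_is_tensor_alg fb gLh; have [i2 j2 e2 _] := t2.
have [w [wh wi wj]] := tensor_alg_lift t1 (ring_hom_comp ioh i2) j2 e2.
(* Flatness of S/PS over R/P, applied to the inclusion of R[X]/Q into its fraction field. *)
have w_inj : injective w.
  apply: (@fbflat (algmod g1h) (algmod gLh) io _ io_inj _ _ _ _ w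
    (tring_mod fb g1h) (tring_mod fb gLh)).
  - by move=> a x y; rewrite (ring_homD ioh) !algmod_scaleE (ring_homM ioh).
  - exact: ring_homD.
  - move=> m y; have := congr2 *%R (wi m) (wj y); rewrite -(ring_homM wh) !tring_pureM.
    by rewrite !mulr1 !mul1r.
have [th [thh thc thX]] := polyring_map hPB (fun i => tring_pure fb g1h (e (XA i)) 1)
  (ring_hom_comp q2h j1).
have thF q : th (F q) = tring_pure fb g1h (e q) 1.
  apply: (polyring_ext hPA (ring_hom_comp hF thh) (ring_hom_comp eh i1)) => [a|i].
    by rewrite Fc thc -fbq -e1 g1q.
  by rewrite FX thX.
have th_ext x : ext_ideal F Q x -> th x = 0.
  move: x; apply: ext_min; first exact: ideal_ker.
  by move=> q /eI eq0; rewrite thF eq0 (ring_hom0 i1).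
have QBi := ext_ideal_is_ideal F Q.
(* The quotient of S[X] by Q S[X] receives maps from R[X]/Q and from S/PS, hence from [T1]; composed
   with [th] this is the projection. *)
have th_ker x : th x = 0 -> ext_ideal F Q x.
  have [W [pi hpi]] := quotient_exists QBi; have [pih pis piI] := hpi.
  have [|uE [uEh uEe]] := quotient_lift he (ring_hom_comp hF pih).
    by move=> q Qq; apply/piI; apply: ext_gen.
  have [|uS [uSh uSq]] := quotient_lift hq2 (ring_hom_comp hcB pih).
    apply: ext_min; first exact: (ideal_ker (ring_hom_comp hcB pih)).
    by move=> a /Pp ha; apply/piI; rewrite -Fc; apply: ext_gen.
  have [|v [vh vi vj]] := tensor_alg_lift t1 uEh uSh.
    by move=> a'; have [a <-] := q1s a'; rewrite g1q uEe fbq uSq Fc.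
  have E0 : pi x = v (th x).
    apply: (polyring_ext hPB pih (ring_hom_comp thh vh)) => [b|i].
      by rewrite thc vj uSq.
    by rewrite thX vi uEe FX.
  by move=> h0; apply/piI; rewrite E0 h0 (ring_hom0 vh).
have [T20|T20] := pselect ((1 : T2) = 0).
  right; apply: th_ker; apply: w_inj.
  by rewrite (ring_hom1 thh) (ring_hom1 wh) (ring_hom0 wh).
left.
suff [_ T2d] : is_domain T2.
  split=> //.
    by move=> /th_ext th0; apply: T20; rewrite -(ring_hom1 wh) -(ring_hom1 thh) th0 (ring_hom0 wh).
  move=> x y /th_ext xy0.
  have : w (th x) * w (th y) = 0 by rewrite -(ring_homM wh) -(ring_homM thh) xy0 (ring_hom0 wh).
  by case/T2d => h0; [left | right]; apply: th_ker; apply: w_inj; rewrite h0 (ring_hom0 wh).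
(* [T2] is L (x) (kappa_p (x)_R S) over kappa_p, where p is the contraction of [Q]: since P lies in
   p, it dies in [L], and tensoring over R/P with S/PS agrees with tensoring over R with S. *)
have [K [k [hres kp]]] := residue_field_exists pp; have [kh kP kU kup] := hres.
have [l [[lh lk] _]] : exists! l : K -> L, ring_hom l /\ forall a, l (k a) = ell (cA a).
  apply: kup; first exact: ring_hom_comp hcA ellh.
    by move=> a pa; apply/ellQ.
  move=> a npa; have nz : ell (cA a) != 0 by apply/eqP => /ellQ.
  by exists (ell (cA a))^-1; rewrite mulfV.
have t3 := tring_is_tensor_alg h kh; have [i3 j3 e3 _] := t3.
have [|j [jh ji jj]] := tensor_alg_lift t3 (ring_hom_comp lh i2) (ring_hom_comp q2h j2).
  by move=> a; rewrite lk -gLq -fbq e2.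
have F1 : (1 : tring h kh) <> 0.
  by move=> F0; apply: T20; rewrite -(ring_hom1 jh) F0 (ring_hom0 jh).
apply: (hfib p pp K k hres _ _ _ t3 F1 L l lh T2 (fun c => tring_pure fb gLh c 1) j).
split=> //.
move=> D u v uh vh uv.
have [|v2 [v2h v2q]] := quotient_lift hq2 (ring_hom_comp j3 vh).
  apply: ext_min; first exact: (ideal_ker (ring_hom_comp j3 vh)).
  by move=> a /Pp pa; rewrite -e3 kP // (ring_hom0 i3) (ring_hom0 vh).
have [|z [zh zi zj]] := tensor_alg_lift t2 uh v2h.
  by move=> a'; have [a <-] := q1s a'; rewrite gLq -lk uv fbq v2q e3.
exists z; split.
  split=> // c; apply: (tensor_alg_ext t3 (ring_hom_comp jh zh) vh) => [x|b].
    by rewrite ji zi uv.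
  by rewrite jj zj v2q.
move=> z' [zh' zi' zj']; apply: funext; apply: (tensor_alg_ext t2 zh zh') => [c|b'].
  by rewrite zi zi'.
by have [b <-] := q2s b'; rewrite -jj zj' jj zj v2q.
Qed.

Theorem theorem3p6 (R S : comPzRingType) (h : R -> S) (hh : ring_hom h) :
  (stable_PEP h -> fibers_geom_red_irr h) /\
  (fibers_geom_red_irr h ->
    (* (i) <-> (ii) *)
    (stable_PEP h <-> on_quotient_map h (@nilradical R) (fun Q1 Q2 fb => stable_PEP fb)) /\
    (* (i) <-> (iii) *)
    (stable_PEP h <-> forall P : R -> Prop, minimal_prime P ->
        on_quotient_map h P (fun Q1 Q2 fb => flat fb)) /\
    (* (i) <-> (iv) *)
    (stable_PEP h <-> forall J : R -> Prop, finite_int_primes J ->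
        on_quotient_map h J (fun Q1 Q2 fb => flat fb))).
Proof.
have i_iv (J : R -> Prop) : stable_PEP h -> finite_int_primes J ->
    on_quotient_map h J (fun Q1 Q2 fb => flat fb).
  move=> hS hJ Q1 q1 Q2 q2 fb hq1 hq2 hfb fbq; apply: eqcrit_flat => //.
  exact: eqcrit_quotient hq1 hq2 fbq hh (stable_PEP_eqcrit_int hh hS hJ).
(* A prime is the intersection of a one-element family, so (iv) contains (iii), which closes the
   cycle. *)
have min_int (P : R -> Prop) : minimal_prime P -> finite_int_primes P.
  move=> [Pp _]; exists [:: P]; split=> //; split=> [Q [<-|[]] //|x].
  by split=> [Px Q [<-|[]] //|]; apply; left.
split; first exact: stable_PEP_fibers.
move=> hfib; split; [|split]; split.
- exact: stable_PEP_quotient.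
- exact: stable_PEP_of_nilquotient.
- by move=> hS P /min_int; apply: i_iv.
- exact: flat_stable_PEP.
- by move=> hS J; apply: i_iv.
- by move=> hiv; apply: flat_stable_PEP => // P /min_int; apply: hiv.
Qed.
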